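(* Let $p$ be a prime. A series $x=\sum_ix_it^i\in\overline{\mathbb{F}}_p((t^{\mathbb{Q}}))$ is integral over $\overline{\mathbb{F}}_p((t))$ if and only if the following hold: (a) there exist integers $a>0$, $b$, $c\ge0$ such that $x$ is supported on $S_{a,b,c}$; (b) for some such $a,b,c$ there exist integers $M,N$ such that for each integer $m\ge-b$, the function $f_m:T_c\to\overline{\mathbb{F}}_p$, $f_m(z)=x_{(m+z)/a}$, has the property that every sequence \[ c_n=f_m\bigl(-b_1p^{-1}-\cdots-b_{j-1}p^{-j+1}-p^{-n}(b_jp^{-j}+b_{j+1}p^{-j-1}+\cdots)\bigr)\qquad(n\ge0), \] with $j$ a positive integer and $b_1,b_2,\ldots\in\{0,\dots,p-1\}$ not all zero with $\sum_ib_i\le c$, becomes periodic of period $N$ after at most $M$ terms.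
   Context: $\overline{\mathbb{F}}_p((t^{\mathbb{Q}}))$ is the field of generalized (Hahn) power series $\sum_{i\in\mathbb{Q}}x_it^i$ with $x_i\in\overline{\mathbb{F}}_p$ and well-ordered support. For integers $a>0$, $b$, $c\ge0$, $S_{a,b,c}$ is the set of rationals $\frac1a(n-b_1p^{-1}-b_2p^{-2}-\cdots)$ with $n\ge-b$ an integer, $b_i\in\{0,\dots,p-1\}$, $\sum_ib_i\le c$; and $T_c=S_{1,0,c}\cap(-1,0)$. *)

(* Defs.v *)
From HB Require Import structures.
From mathcomp Require Import all_boot all_order all_algebra.
From mathcomp Require Import boolp classical_sets functions cardinality fsbigop.
Set Implicit Arguments. Unset Strict Implicit. Unset Printing Implicit Defensive.
Import Order.TTheory GRing.Theory Num.Theory.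
Local Open Scope classical_set_scope.
Local Open Scope ring_scope.

(* A (generalized) series sum_{i in Q} x_i t^i is represented by its
   coefficient function x : rat -> K. *)

Definition well_ordered_support (K : fieldType) (x : rat -> K) : Prop :=
  forall A : set rat, A `<=` [set q | x q != 0] -> A !=set0 ->
    exists2 m, A m & forall q, A q -> m <= q.

Definition is_laurent (K : fieldType) (y : rat -> K) : Prop :=
  exists k : int, forall q, y q != 0 -> exists2 n : int, q = n%:~R & k <= n.

(* Product of Hahn series: (x y)_e = sum_{u} x_u y_{e-u} (a finite sum for
   series with well-ordered support). *)
Definition hmul (K : fieldType) (x y : rat -> K) : rat -> K :=
  fun e => \sum_(u \in [set: rat]) (x u * y (e - u)).

Definition hone (K : fieldType) : rat -> K := fun e => if e == 0 then 1 else 0.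

Definition hpow (K : fieldType) (x : rat -> K) (n : nat) : rat -> K :=
  iter n (hmul x) (hone K).

Definition integral_over_laurent (K : fieldType) (x : rat -> K) : Prop :=
  exists (n : nat) (A : nat -> rat -> K),
    (forall i, (i < n)%N -> is_laurent (A i)) /\
    forall e, hpow x n e + \sum_(i < n) hmul (A i) (hpow x i) e = 0.

(* b_1 p^-1 + b_2 p^-2 + ... for a finite digit list bs = [b_1; b_2; ...]
   (the remaining digits being 0). *)
Definition digval (p : nat) (bs : seq nat) : rat :=
  \sum_(i < size bs) (nth 0%N bs i)%:R * (p%:R ^- i.+1).

Definition digits_ok (p c : nat) (bs : seq nat) : bool :=
  all (fun d => (d < p)%N) bs && (sumn bs <= c)%N.

Definition S_abc (p a : nat) (b : int) (c : nat) : set rat :=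
  [set q | exists (n : int) (bs : seq nat),
     [/\ - b <= n, digits_ok p c bs & q = (n%:~R - digval p bs) / a%:R]].

Definition T_c (p c : nat) : set rat :=
  S_abc p 1 0 c `&` [set q | -1 < q < 0].

Definition shifted_point (p : nat) (bs : seq nat) (j n : nat) : rat :=
  - (\sum_(i < size bs | (i.+1 < j)%N) (nth 0%N bs i)%:R * (p%:R ^- i.+1))
  - (p%:R ^- n) * (\sum_(i < size bs | (j <= i.+1)%N) (nth 0%N bs i)%:R * (p%:R ^- i.+1)).

Definition f_m (K : fieldType) (x : rat -> K) (a : nat) (m : int) (z : rat) : K :=
  x ((m%:~R + z) / a%:R).

Definition supported_on (K : fieldType) (x : rat -> K) (S : set rat) : Prop :=
  forall q, x q != 0 -> S q.

Definition eventually_periodic (K : Type) (u : nat -> K) (M N : nat) : Prop :=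
  forall n, (M <= n)%N -> u (n + N)%N = u n.

(* Main.v *)
(* Let F be the p-th power map, which acts on coefficients by
   (F x)_q = (x_(q/p))^p.

   If x is integral, then by Ore's trick sum_i A_i F^i x = 0 for Laurent series
   A_i, not all zero; replacing x by a power F^r x and rescaling exponents, we may
   assume A_0 <> 0.  The first slope of the Newton polygon of the operator has
   denominator p^i - 1, so after rescaling exponents by p^i - 1 Hensel's lemma
   gives a root w which is itself a Laurent series; substituting x = w z factors
   the operator through z |-> z^p - z.  Hence x is reached from 0 by solving
   Artin-Schreier equations z^p - z = g and multiplying by Laurent series, and
   both steps preserve "bounded digit sums and periodic coefficients".  For the
   Artin-Schreier step, q < 0 is handled by z_q^p = z_(pq) + g_(pq) and q > 0 by
   z_q = z_(q/p)^p - g_q; periodicity along -p^(-n) zeta uses that the finitely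
   many values of g at negative exponents lie in one finite field.

   Conversely the series with given bounds on digit sums and periods (after
   rescaling exponents by a) form a space which is stable under F and over the
   Laurent series, and whose elements are determined by finitely many slices
   sum_n x_(n+q) t^n, because long digit strings contain long runs of zeros which
   periodicity shortens.  Hence x, F x, F^2 x, ... are linearly dependent. *)

Require Import Defs.
From HB Require Import structures.
From mathcomp Require Import all_boot all_order all_algebra.
From mathcomp Require Import boolp classical_sets functions cardinality fsbigop.
From mathcomp Require Import ring lra zify.
Set Implicit Arguments. Unset Strict Implicit. Unset Printing Implicit Defensive.
Import Order.TTheory GRing.Theory Num.Theory.
Local Open Scope classical_set_scope.
Local Open Scope ring_scope.

(** * Well-ordered sets of rationals *)

(** Phrased for sets so that [well_ordered_support x] is, by conversion, [wo] of the support of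
    [x]. *)
Definition wo (A : set rat) : Prop :=
  forall B, B `<=` A -> B !=set0 -> exists2 m, B m & forall q, B q -> m <= q.

Lemma wo_sub (A B : set rat) : A `<=` B -> wo B -> wo A.
Proof. by move=> AB woB C CA; apply: woB; apply: subset_trans CA AB. Qed.

Lemma wo_union (A B : set rat) : wo A -> wo B -> wo (A `|` B).
Proof.
move=> woA woB C CAB [c Cc].
have [[u ACu]|nA] := pselect ((A `&` C) !=set0); last first.
  apply: woB; last by exists c.
  by move=> q Cq; case: (CAB _ Cq) => // Aq; case: nA; exists q.
have [[v BCv]|nB] := pselect ((B `&` C) !=set0); last first.
  apply: woA; last by exists c.
  by move=> q Cq; case: (CAB _ Cq) => // Bq; case: nB; exists q.
have [m1 [Am1 Cm1] le1] := woA (A `&` C) (@subIsetl _ _ _) (ex_intro _ u ACu).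
have [m2 [Bm2 Cm2] le2] := woB (B `&` C) (@subIsetl _ _ _) (ex_intro _ v BCv).
have [m12|m21] := leP m1 m2.
  exists m1 => // q Cq; case: (CAB _ Cq) => [Aq|Bq]; first exact: le1.
  by apply: le_trans m12 _; apply: le2.
exists m2 => // q Cq; case: (CAB _ Cq) => [Aq|Bq]; last exact: le2.
by apply: le_trans (ltW m21) _; apply: le1.
Qed.

Lemma wo_inj (A B : set rat) (f : rat -> rat) :
  {mono f : x y / x <= y} -> (forall q, A q -> B (f q)) -> wo B -> wo A.
Proof.
move=> fm AB woB C CA [c Cc].
have [||_ [m Cm <-] mle] := woB [set f q | q in C].
- by move=> _ [q Cq <-]; apply/AB/CA.
- by exists (f c), c.
by exists m => // q Cq; rewrite -fm; apply: mle; exists q.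
Qed.

(** If some initial segment of [A] is infinite, take the least endpoint [m] of such a segment: the
    elements below [m] have a largest one, whose segment is finite, a contradiction. If all segments
    are finite, the one ending at the maximum is [A]. *)
Lemma wo_finite (A : set rat) :
  wo A -> wo [set q | A (- q)] -> finite_set A.
Proof.
move=> woA woN.
pose I u := A `&` [set q | q <= u].
have [[u0 [Au0 infu0]]|fin] :=
  pselect ([set u | A u /\ ~ finite_set (I u)] !=set0).
- have [||m [Am infm] mle] := woA [set u | A u /\ ~ finite_set (I u)].
  + by move=> u [].
  + by exists u0.
  exfalso; apply: infm.
  have [[v [Av vm]]|lt0] := pselect ((A `&` [set q | q < m]) !=set0); last first.
    apply: (@sub_finite_set _ _ [set m]); last exact: finite_set1.
    move=> q [Aq qm]; apply/eqP; rewrite eq_le qm /= leNgt.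
    by apply/negP => qm'; apply: lt0; exists q.
  have [||w [Aw wm] wle] := woN [set q | A (- q) /\ - q < m].
  + by move=> q [].
  + by exists (- v) => /=; rewrite opprK.
  have finw : finite_set (I (- w)).
    apply: contrapT => infw.
    have /mle : A (- w) /\ ~ finite_set (I (- w)) by [].
    by rewrite leNgt wm.
  apply: (@sub_finite_set _ _ (I (- w) `|` [set m])); last first.
    by rewrite finite_setU; split=> //; apply: finite_set1.
  move=> q [Aq qm]; move: qm; rewrite /= le_eqVlt => /orP[/eqP->|qm].
    by right.
  left; split=> //=; rewrite lerNr; apply: wle => /=; rewrite opprK; by split.
- have [[c Ac]|A0] := pselect (A !=set0); last first.
    apply: (@sub_finite_set _ _ set0); last exact: finite_set0.
    by move=> q Aq; case: A0; exists q.
  have [|| m Am mle] := woN [set q | A (- q)].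
  + by [].
  + by exists (- c) => /=; rewrite opprK.
  apply: (@sub_finite_set _ _ (I (- m))).
    move=> q Aq; split => //=; rewrite lerNr; apply: mle => /=; by rewrite opprK.
  by apply: contrapT => inf; apply: fin; exists (- m).
Qed.

(* Among the sums in C, let m p be the least one with a summand p; the p at
   which m takes a new strict minimum are increasing, so that the other summand
   m p - p is strictly decreasing along them. *)
Lemma wo_add (P Q : set rat) :
  wo P -> wo Q -> wo [set e | exists u, P u /\ Q (e - u)].
Proof.
move=> woP woQ C CPQ [c Cc]; apply: contrapT => nomin.
pose Cp p := [set e | C e /\ Q (e - p)].
pose isM p m := [/\ P p, Cp p m & forall e, Cp p e -> m <= e].
have exM e p : C e -> P p -> Q (e - p) -> exists2 m, isM p m & m <= e.
  move=> Ce Pp Qep.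
  have [||m0 [Cm Qm] mle] := woQ [set r | C (r + p) /\ Q r].
  - by move=> r [].
  - by exists (e - p); rewrite /= subrK.
  exists (m0 + p); last first.
    by rewrite -lerBrDr; apply: mle; rewrite /= subrK.
  split=> //; first by split; rewrite // addrK.
  move=> e' [Ce' Qe']; rewrite -lerBrDr; apply: mle; by rewrite /= subrK.
have descend p m : isM p m -> exists p' m', isM p' m' /\ m' < m.
  move=> [Pp [Cm Qm] mle].
  have [e Ce em] : exists2 e, C e & e < m.
    apply: contrapT => h; apply: nomin; exists m => // q Cq.
    by rewrite leNgt; apply/negP => qm; apply: h; exists q.
  have [u [Pu Qu]] := CPQ _ Ce.
  have [m' Mm' m'e] := exM _ _ Ce Pu Qu.
  by exists u, m'; split=> //; apply: le_lt_trans m'e em.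
pose isrec p m := isM p m /\ forall p' m', isM p' m' -> p' < p -> m < m'.
have recnext p m : isM p m -> exists p' m',
    [/\ isrec p' m', m' < m & forall p2 m2, isM p2 m2 -> m2 < m -> p' <= p2].
  move=> Mpm.
  have [||p' [m' [Mm' m'm]] p'le] := woP [set p' | exists m', isM p' m' /\ m' < m].
  - by move=> q [m' [[]]].
  - by have [p' [m' h]] := descend _ _ Mpm; exists p', m'.
  exists p', m'; split=> //.
    split=> // p2 m2 M2 p2lt; rewrite ltNge; apply/negP => m2le.
    have /p'le : exists m2, isM p2 m2 /\ m2 < m.
      by exists m2; split=> //; apply: le_lt_trans m2le m'm.
    by rewrite leNgt p2lt.
  by move=> p2 m2 M2 m2lt; apply: p'le; exists m2.
have [u [Pu Qu]] := CPQ _ Cc.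
have [m0 Mm0 _] := exM _ _ Cc Pu Qu.
have [p1 [m1 [rec1 _ _]]] := recnext _ _ Mm0.
have [||r [p [m [[Mpm recpm] rE]]] rle] :=
    woQ [set r | exists p m, isrec p m /\ r = m - p].
- by move=> r [p [m [[[Pp [Cm Qm] _] _] ->]]].
- by exists (m1 - p1), p1, m1.
have [p' [m' [rec' m'm p'le]]] := recnext _ _ Mpm.
have pp' : p <= p'.
  rewrite leNgt; apply/negP => p'p.
  by have := recpm _ _ (proj1 rec') p'p; rewrite ltNge (ltW m'm).
have /rle : exists p m, isrec p m /\ m' - p' = m - p by exists p', m'.
by rewrite rE leNgt ltr_leD // lerN2.
Qed.

(** * The ring of Hahn series *)

Section HmulSeq.
Variable K : fieldType.
Implicit Types x y z : rat -> K.

Lemma hmul_fin x y e : well_ordered_support x -> well_ordered_support y ->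
  finite_set [set u | x u != 0 /\ y (e - u) != 0].
Proof.
move=> wx wy; apply: wo_finite; first by apply: wo_sub wx => u [].
apply: (@wo_inj _ [set q | y q != 0] (fun q => q + e)) wy.
  by move=> u v; rewrite lerD2r.
by move=> q [_]; rewrite opprK addrC.
Qed.

(** Any sufficiently large list will do, so that several products can be computed over a common
    one. *)
Lemma hmul_seq x y e (s : seq rat) : uniq s ->
  (forall u, x u != 0 -> y (e - u) != 0 -> u \in s) ->
  hmul x y e = \sum_(u <- s) x u * y (e - u).
Proof.
move=> us sP; rewrite fsbig_seq //; apply: esym.
apply: fsbig_widen => //= u [_ us'].
apply: contrapT => /eqP; rewrite mulf_eq0 negb_or => /andP[x0 y0].
by apply: us'; apply: sP.
Qed.

Lemma hmul_dom x y e : well_ordered_support x -> well_ordered_support y ->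
  exists2 s : seq rat, uniq s &
    forall u, x u != 0 -> y (e - u) != 0 -> u \in s.
Proof.
move=> wx wy; have /finite_seqP[s sE] := hmul_fin e wx wy.
exists (undup s); first exact: undup_uniq.
move=> u xu yu; rewrite mem_undup.
by have : [set` s] u by rewrite -sE.
Qed.

Lemma hmul_neq0 x y e : hmul x y e != 0 -> exists u, x u != 0 /\ y (e - u) != 0.
Proof.
move=> h; apply: contrapT => none; move/eqP: h; apply.
rewrite (@hmul_seq _ _ _ [::]) ?big_nil // => u xu yu.
by case: none; exists u.
Qed.

Lemma hmul_wo x y : well_ordered_support x -> well_ordered_support y ->
  well_ordered_support (hmul x y).
Proof.
move=> wx wy; apply: (wo_sub (B := [set e | exists u, x u != 0 /\ y (e - u) != 0])).
  by move=> e /hmul_neq0.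
exact: (wo_add wx wy).
Qed.

Lemma hmulC x y : well_ordered_support x -> well_ordered_support y ->
  hmul x y = hmul y x.
Proof.
move=> wx wy; apply: funext => e; have [s us sP] := hmul_dom e wx wy.
rewrite (hmul_seq us sP) (@hmul_seq _ _ _ [seq e - u | u <- s]).
- by rewrite big_map; apply: eq_bigr => u _; rewrite subKr mulrC.
- by rewrite map_inj_uniq // => u v /addrI/oppr_inj.
- by move=> u yu xu; apply/mapP; exists (e - u); rewrite ?subKr //; apply: sP; rewrite ?subKr.
Qed.

Lemma hmulA x y z : well_ordered_support x -> well_ordered_support y ->
  well_ordered_support z -> hmul x (hmul y z) = hmul (hmul x y) z.
Proof.
move=> wx wy wz; apply: funext => e.
have wyz := hmul_wo wy wz; have wxy := hmul_wo wx wy.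
(* Defined through pairs and not by [hmul x y v != 0]: the coefficient may cancel while single terms
   survive. *)
have /finite_seqP[V0 V0E] : finite_set
    [set v | (exists u, x u != 0 /\ y (v - u) != 0) /\ z (e - v) != 0].
  apply: wo_finite; first by apply: wo_sub (wo_add wx wy) => v [].
  apply: (@wo_inj _ [set q | z q != 0] (fun q => q + e)) wz.
    by move=> u v; rewrite lerD2r.
  by move=> q [_]; rewrite opprK addrC.
have V0P v : (exists u, x u != 0 /\ y (v - u) != 0) -> z (e - v) != 0 -> v \in undup V0.
  by move=> h1 h2; rewrite mem_undup; have : [set` V0] v by rewrite -V0E.
have [U0 U0u U0P] := hmul_dom e wx wyz.
(* One list [U] serves the sum over [u] for every [v], which permits exchanging the summations. *)
have [U uU UP] : exists2 U : seq rat, uniq U & {subset U0 <= U} /\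
    forall v, v \in undup V0 -> forall u, x u != 0 -> y (v - u) != 0 -> u \in U.
  elim: (undup V0) => [|v s [U uU [UP1 UP2]]]; first by exists U0 => //; split.
  have [t tu tP] := hmul_dom v wx wy.
  exists (undup (t ++ U)); first exact: undup_uniq.
  split=> [u /UP1|v']; first by rewrite mem_undup mem_cat => ->; rewrite orbT.
  rewrite inE => /predU1P[->|vs] u xu yu; rewrite mem_undup mem_cat.
    by rewrite tP.
  by rewrite (UP2 v') ?orbT.
have V0u := undup_uniq V0; case: UP => U0U UP.
rewrite (@hmul_seq _ _ _ U uU); last by move=> u xu yzu; apply/U0U/U0P.
rewrite (@hmul_seq _ _ _ (undup V0)) //; last first.
  by move=> v /hmul_neq0 h1 h2; apply: V0P.
under [RHS]eq_big_seq => v vV.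
  rewrite (@hmul_seq _ _ _ U uU); last by move=> u xu yu; apply: UP vV _ xu yu.
  rewrite big_distrl /=; over.
rewrite exchange_big; apply: eq_bigr => u _.
have [->|xu] := eqVneq (x u) 0.
  by rewrite mul0r big1 // => v _; rewrite !mul0r.
rewrite (@hmul_seq _ _ _ [seq v - u | v <- undup V0]).
- rewrite big_map big_distrr; apply: eq_bigr => v _ /=.
  by rewrite mulrA; congr (_ * _ * z _); rewrite opprB addrA subrK.
- by rewrite map_inj_uniq // => v w /addIr.
- move=> w yw zw; apply/mapP; exists (w + u); rewrite ?addrK //.
  apply: V0P; first by exists u; rewrite addrK.
  by rewrite opprD addrA addrAC.
Qed.

Lemma hmulDl x y z : well_ordered_support x -> well_ordered_support y ->
  well_ordered_support z -> hmul (x \+ y) z = (hmul x z \+ hmul y z).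
Proof.
move=> wx wy wz; apply: funext => e /=.
have [s us sP] := hmul_dom e wx wz; have [t ut tP] := hmul_dom e wy wz.
have sub (r : rat -> K) : (forall u, r u != 0 -> x u != 0 \/ y u != 0) ->
    hmul r z e = \sum_(u <- undup (s ++ t)) r u * z (e - u).
  move=> rP; apply: hmul_seq; first exact: undup_uniq.
  move=> u ru zu; rewrite mem_undup mem_cat.
  by case: (rP u ru) => h; [rewrite sP | rewrite tP ?orbT].
rewrite (sub x) ?(sub y) ?(sub (x \+ y)).
- by rewrite -big_split; apply: eq_bigr => u _; rewrite /= mulrDl.
- by move=> u /=; have [->|] := eqVneq (x u) 0; [rewrite add0r; right | left].
- by right.
- by left.
Qed.

Lemma hmul1 x : hmul (hone K) x = x.
Proof.
apply: funext => e; rewrite (@hmul_seq _ _ _ [:: 0]) //.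
  by rewrite big_seq1 /hone eqxx mul1r subr0.
by move=> u; rewrite /hone inE; case: (u =P 0) => // _; rewrite eqxx.
Qed.

Lemma wo_single (a : rat) (c : K) : well_ordered_support (fun e => if e == a then c else 0).
Proof.
move=> A Aa [q Aq]; have sing r : A r -> r = a.
  by move/Aa => /=; case: (r =P a) => // _; rewrite eqxx.
by exists q => // r Ar; rewrite (sing _ Aq) (sing _ Ar).
Qed.

End HmulSeq.

Record hahn (K : fieldType) :=
  Hahn { hcoef :> rat -> K; hahnP : well_ordered_support hcoef }.
Arguments hahnP {K} h : rename.

HB.instance Definition _ (K : fieldType) := gen_eqMixin (hahn K).
HB.instance Definition _ (K : fieldType) := gen_choiceMixin (hahn K).

Section HahnRing.
Variable K : fieldType.
Implicit Types x y z : hahn K.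

Lemma hahn_eq x y : (forall q, x q = y q) -> x = y.
Proof.
case: x y => [x wx] [y wy] /= /funext xy; case: y / xy wy => wy.
by congr Hahn; apply: Prop_irrelevance.
Qed.

Lemma zero_wo : well_ordered_support (fun _ : rat => 0 : K).
Proof. by move=> A A0 [q /A0]; rewrite /= eqxx. Qed.

Lemma add_wo x y : well_ordered_support (fun q => x q + y q).
Proof.
apply: (@wo_sub _ ([set q | x q != 0] `|` [set q | y q != 0])); last first.
  by apply: wo_union; apply: hahnP.
move=> q /=; by have [->|] := eqVneq (x q) 0; [rewrite add0r; right | left].
Qed.

Lemma opp_wo x : well_ordered_support (fun q => - x q).
Proof.
apply: (@wo_sub _ [set q | x q != 0]); last exact: hahnP.
by move=> q /=; rewrite oppr_eq0.
Qed.

Lemma haddA : associative (fun x y => Hahn (@add_wo x y)).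
Proof. by move=> x y z; apply: hahn_eq => q /=; rewrite addrA. Qed.
Lemma haddC : commutative (fun x y => Hahn (@add_wo x y)).
Proof. by move=> x y; apply: hahn_eq => q /=; rewrite addrC. Qed.
Lemma hadd0 : left_id (Hahn zero_wo) (fun x y => Hahn (@add_wo x y)).
Proof. by move=> x; apply: hahn_eq => q /=; rewrite add0r. Qed.
Lemma haddN : left_inverse (Hahn zero_wo) (fun x => Hahn (@opp_wo x))
  (fun x y => Hahn (@add_wo x y)).
Proof. by move=> x; apply: hahn_eq => q /=; rewrite addNr. Qed.

HB.instance Definition _ := GRing.isZmodule.Build (hahn K) haddA haddC hadd0 haddN.

Definition hahn_mul x y := Hahn (hmul_wo (hahnP x) (hahnP y)).
Definition hahn_one : hahn K := Hahn (@wo_single K 0 1).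

Lemma hahn_mulA : associative hahn_mul.
Proof. by move=> x y z; apply: hahn_eq => q /=; rewrite hmulA //; apply: hahnP. Qed.
Lemma hahn_mulC : commutative hahn_mul.
Proof. by move=> x y; apply: hahn_eq => q /=; rewrite hmulC //; apply: hahnP. Qed.
Lemma hahn_mul1 : left_id hahn_one hahn_mul.
Proof. by move=> x; apply: hahn_eq => q; exact: (congr1 (fun f => f q) (hmul1 x)). Qed.
Lemma hahn_mulDl : left_distributive hahn_mul +%R.
Proof.
move=> x y z; apply: hahn_eq => q.
exact: (congr1 (fun f => f q) (hmulDl (hahnP x) (hahnP y) (hahnP z))).
Qed.
Lemma hahn_one_neq0 : hahn_one != 0.
Proof.
apply/eqP => /(congr1 (fun x : hahn K => x 0)) /=.
by move/eqP; rewrite oner_eq0.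
Qed.

HB.instance Definition _ := GRing.Zmodule_isComNzRing.Build (hahn K)
  hahn_mulA hahn_mulC hahn_mul1 hahn_mulDl hahn_one_neq0.

Lemma hcoef0 q : (0 : hahn K) q = 0. Proof. by []. Qed.
Lemma hcoefD x y q : (x + y) q = x q + y q. Proof. by []. Qed.
Lemma hcoefN x q : (- x) q = - x q. Proof. by []. Qed.
Lemma hcoef1 q : (1 : hahn K) q = if q == 0 then 1 else 0. Proof. by []. Qed.
Lemma hcoefM x y : hcoef (x * y) = hmul x y. Proof. by []. Qed.
Lemma hcoef_sum (I : Type) (r : seq I) (P : pred I) (F : I -> hahn K) q :
  (\sum_(i <- r | P i) F i) q = \sum_(i <- r | P i) F i q.
Proof. by elim/big_rec2: _ => // i a b _ <-. Qed.

Lemma hcoefX x n : hcoef (x ^+ n) = hpow x n.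
Proof. by elim: n => [//|n IHn]; rewrite exprS hcoefM IHn. Qed.

Lemma hmul_seqP x y e (s : seq rat) : uniq s ->
  (forall u, x u != 0 -> y (e - u) != 0 -> u \in s) ->
  (x * y) e = \sum_(u <- s) x u * y (e - u).
Proof. exact: hmul_seq. Qed.

Lemma coefM_neq0 x y e : (x * y) e != 0 -> exists u, x u != 0 /\ y (e - u) != 0.
Proof. exact: hmul_neq0. Qed.

Definition hmono (a : rat) (c : K) : hahn K := Hahn (@wo_single K a c).

Lemma hmonoM a c x e : (hmono a c * x) e = c * x (e - a).
Proof.
rewrite (@hmul_seqP _ _ _ [:: a]) //; first by rewrite big_seq1 /= eqxx.
by move=> u /=; rewrite inE; case: (u =P a) => // _; rewrite eqxx.
Qed.

Lemma hmono_neq0 a c e : hmono a c e != 0 -> e = a.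
Proof. by rewrite /=; case: (e =P a) => // _; rewrite eqxx. Qed.

End HahnRing.

(** * Laurent series *)

Section Laurent.
Variable K : fieldType.
Implicit Types x y z f g : hahn K.

Lemma laurent_wo (y : rat -> K) : is_laurent y -> well_ordered_support y.
Proof.
move=> [k yk] B By [q Bq].
pose P j := `[< B (k + j%:Z)%:~R >].
have inP r : B r -> exists2 j, P j & r = (k + j%:Z)%:~R.
  move=> Br; have [n rn kn] := yk _ (By _ Br).
  exists `|n - k|%N; last by rewrite gez0_abs ?subr_ge0 // [k + _]addrC subrK.
  by apply/asboolP; rewrite gez0_abs ?subr_ge0 // [k + _]addrC subrK -rn.
have exP : exists j, P j by have [j] := inP _ Bq; exists j.
case: (ex_minnP exP) => m /asboolP Bm mle.
exists ((k + m%:Z)%:~R) => // r Br; have [j Pj ->] := inP _ Br.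
by rewrite ler_int lerD2l; apply: mle.
Qed.

Definition laurent_pred : {pred hahn K} := fun x => `[< is_laurent x >].

Lemma laurent_subring : subring_closed laurent_pred.
Proof.
split.
- apply/asboolP; exists 0 => q; rewrite hcoef1; case: (q =P 0) => [-> _|_].
    by exists 0.
  by rewrite eqxx.
- move=> x y /asboolP[k xk] /asboolP[l yl]; apply/asboolP; exists (Num.min k l) => q.
  rewrite hcoefD hcoefN; have [x0|x0 _] := eqVneq (x q) 0.
    rewrite x0 sub0r oppr_eq0 => /yl[n -> ln]; exists n => //.
    by rewrite ge_min ln orbT.
  by have [n -> kn] := xk _ x0; exists n => //; rewrite ge_min kn.
- move=> x y /asboolP[k xk] /asboolP[l yl]; apply/asboolP; exists (k + l) => q.
  move=> /coefM_neq0[u [/xk[n un kn] /yl[m mE lm]]].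
  exists (n + m); last by rewrite lerD.
  by rewrite rmorphD /= -mE -un addrC subrK.
Qed.

HB.instance Definition _ := GRing.isSubringClosed.Build (hahn K) laurent_pred laurent_subring.

Record laurent := Laurent { lval : hahn K; lvalP : lval \in laurent_pred }.

HB.instance Definition _ := [isSub for lval].
HB.instance Definition _ := [Choice of laurent by <:].
HB.instance Definition _ := [SubChoice_isSubComNzRing of laurent by <:].

Lemma laurentE (l : laurent) : is_laurent (lval l).
Proof. by apply/asboolP; apply: lvalP. Qed.

Lemma mklaurent x : is_laurent x -> exists l : laurent, lval l = x.
Proof.
move=> lx; have lx' : x \in laurent_pred by apply/asboolP.
by exists (Laurent lx').
Qed.

(** The ideal $t^s K[[t]]$ of the power series ring, inside the Hahn series. *)
Definition nng (s : nat) x :=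
  forall q, x q != 0 -> exists2 n : nat, (s <= n)%N & q = n%:R.

Lemma nng_laurent s x : nng s x -> is_laurent x.
Proof.
by move=> xs; exists s%:Z => q /xs[n sn ->]; exists n%:Z; rewrite // lez_nat.
Qed.

Lemma nngW s t x : (s <= t)%N -> nng t x -> nng s x.
Proof. by move=> st xt q /xt[n tn ->]; exists n => //; apply: leq_trans tn. Qed.

Lemma nng0 s : nng s 0.
Proof. by move=> q; rewrite hcoef0 eqxx. Qed.

Lemma nngD s x y : nng s x -> nng s y -> nng s (x + y).
Proof.
move=> xs ys q; rewrite hcoefD; have [->|/xs//] := eqVneq (x q) 0.
by rewrite add0r => /ys.
Qed.

Lemma nngN s x : nng s x -> nng s (- x).
Proof. by move=> xs q; rewrite hcoefN oppr_eq0; apply: xs. Qed.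

Lemma nngM s t x y : nng s x -> nng t y -> nng (s + t) (x * y).
Proof.
move=> xs yt q /coefM_neq0[u [/xs[n sn un] /yt[m tm mE]]].
exists (n + m)%N; first by rewrite leq_add.
by rewrite natrD -mE -un addrC subrK.
Qed.

Lemma nng_sum s (I : Type) (r : seq I) (P : pred I) (F : I -> hahn K) :
  (forall i, P i -> nng s (F i)) -> nng s (\sum_(i <- r | P i) F i).
Proof. by move=> Fs; apply: big_ind => //; [exact: nng0|exact: nngD]. Qed.

Lemma nng_mono n c : nng n (hmono n%:R c).
Proof. by move=> q /hmono_neq0 ->; exists n. Qed.

(** Only the coefficients of [f] up to [n - s] enter. This is how maps are shown to be
    contracting. *)
Lemma nngM_local s B f g n : nng s B -> nng 0 f -> nng 0 g ->
  (forall i, (i + s <= n)%N -> f i%:R = g i%:R) ->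
  (B * f) n%:R = (B * g) n%:R.
Proof.
move=> Bs fs gs fg.
have dom h : nng 0 h -> (B * h) n%:R =
    \sum_(u <- [seq j%:R | j <- iota s (n.+1 - s)]) B u * h (n%:R - u).
  move=> hs; apply: hmul_seqP.
    by rewrite map_inj_uniq ?iota_uniq // => i j /eqP; rewrite eqr_nat => /eqP.
  move=> u /Bs[j sj ->] /hs[i _ hi]; apply/mapP; exists j => //.
  have ij : (i + j = n)%N.
    by apply/eqP; rewrite -(eqr_nat rat) natrD -hi subrK.
  by rewrite mem_iota sj subnKC; lia.
rewrite !dom // !big_map; apply: eq_big_seq => j; rewrite mem_iota => /andP[sj jn].
by rewrite -natrB ?fg //; lia.
Qed.

(* The fixed point is read off the iterates at 0: the n-th coefficient of the
   k-th iterate no longer changes once k > n. *)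
Lemma contraction_fixpoint (Psi : hahn K -> hahn K) :
  (forall f, nng 1 f -> nng 1 (Psi f)) ->
  (forall f g n, nng 1 f -> nng 1 g ->
     (forall i, (i < n)%N -> f i%:R = g i%:R) -> Psi f n%:R = Psi g n%:R) ->
  exists2 f, nng 1 f & Psi f = f.
Proof.
move=> Psi1 Psil; pose h k := iter k Psi 0.
have h1 k : nng 1 (h k) by elim: k => [|k IHk]; [exact: nng0 | exact: Psi1].
have hS k n : (n < k)%N -> h k n%:R = h k.+1 n%:R.
  elim: k n => [//|k IHk] n nk; apply: Psil => [||i ik]; [exact: h1 | exact: (h1 k.+1) |].
  by apply: IHk; apply: leq_trans ik _.
have hk k n : (n < k)%N -> h k n%:R = h n.+1 n%:R.
  elim: k => [//|k IHk]; rewrite ltnS leq_eqVlt => /orP[/eqP->//|nk].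
  by rewrite -hS // IHk.
pose fr (q : rat) := let n := `|numq q|%N in if q == n%:R then h n.+1 q else 0.
have frn (n : nat) : fr n%:R = h n.+1 n%:R.
  by rewrite /fr (_ : numq n%:R = n%:Z) ?eqxx // pmulrn numq_int.
have fr1 q : fr q != 0 -> exists2 n : nat, (1 <= n)%N & q = n%:R.
  by rewrite /fr; case: ifP => _; [exact: h1 | rewrite eqxx].
have frw : well_ordered_support fr.
  apply: laurent_wo; exists 0 => q /fr1[n _ ->]; by exists n%:Z.
exists (Hahn frw) => //; apply: hahn_eq => q.
have [[n ->]|nat_q] := pselect (exists n : nat, q = n%:R).
  rewrite [RHS]frn /= -/(h n); apply: Psil => // i ilt.
  by rewrite /= frn (hk n).
have zero f : nng 1 f -> f q = 0.
  move=> f1; apply: contrapT => /eqP/f1[n _ qn]; by apply: nat_q; exists n.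
by rewrite !zero //; apply: Psi1.
Qed.

Lemma lead_term x : is_laurent x -> x <> 0 -> exists v : int,
  x v%:~R != 0 /\ forall q, x q != 0 -> exists2 n : int, q = n%:~R & v <= n.
Proof.
move=> [k xk] x0.
have [||m xm mle] := hahnP x [set q | x q != 0]; first by [].
  apply: contrapT => none; apply: x0; apply: hahn_eq => q; apply: contrapT => /eqP xq.
  by apply: none; exists q.
have [v mv _] := xk _ xm; exists v; split; first by rewrite -mv.
move=> q xq; have [n qn _] := xk _ xq; exists n => //.
by have := mle _ xq; rewrite mv qn ler_int.
Qed.

(** Division by the leading term leaves [1 - m] with [m] of positive order. The fixed point of
    [f = m + m * f] is the geometric series m + m^2 + ..., so [1 + f] inverts [1 - m]. *)
Lemma laurent_inv x : is_laurent x -> x <> 0 -> exists2 y : hahn K, is_laurent y & y * x = 1.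
Proof.
move=> lx x0; have [v [xv xvle]] := lead_term lx x0.
pose m := 1 - hmono (- v%:~R) (x v%:~R)^-1 * x.
have m1 : nng 1 m.
  move=> q; rewrite hcoefD hcoefN hmonoM opprK hcoef1.
  have [->|q0] := eqVneq q 0; first by rewrite add0r mulVf // subrr eqxx.
  rewrite sub0r oppr_eq0 mulf_eq0 negb_or => /andP[_ /xvle[n qn vn]].
  have qE : q = (n - v)%:~R by rewrite rmorphB /= -qn addrK.
  have vn' : v < n.
    rewrite lt_neqAle vn andbT; apply: contraNneq q0 => vn'.
    by rewrite qE vn' subrr.
  by exists `|n - v|%N; [lia | rewrite qE; rewrite pmulrn; congr (_%:~R); lia].
have [||f f1 fE] := @contraction_fixpoint (fun f => m + m * f).
- by move=> f f1; apply: nngD => //; apply: (@nngW 1 2) => //; apply: nngM m1 f1.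
- move=> f g n f1 g1 fg; rewrite !hcoefD; congr (_ + _).
  apply: (nngM_local m1); try by apply: (@nngW 0 1).
  by move=> i; rewrite addn1; apply: fg.
exists ((1 + f) * hmono (- v%:~R) (x v%:~R)^-1).
  have lM (y z : hahn K) : is_laurent y -> is_laurent z -> is_laurent (y * z).
    move=> ly lz; have [_ _ h] := laurent_subring.
    by apply/asboolP; apply: h; apply/asboolP.
  apply: lM; last by exists (- v) => q /hmono_neq0 ->; exists (- v); rewrite // rmorphN.
  apply: (@nng_laurent 0); apply: nngD; last exact: (@nngW 0 1).
  exact: (nng_mono (n := 0)).
rewrite -mulrA (_ : hmono _ _ * x = 1 - m); last by rewrite /m opprB addrC subrK.
by rewrite mulrBr mulr1 mulrDl mul1r [f * m]mulrC fE addrK.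
Qed.

(** The default value 0 makes the inverse of 0 equal to 0, as the field structure demands. *)
Definition laurent_invr (l : laurent) : laurent := xget 0 [set y | y * l = 1].

Lemma laurent_mulVf l : l != 0 -> laurent_invr l * l = 1.
Proof.
move=> l0; apply: (@xgetPex _ _ [set y | y * l = 1]).
have [|y ly yl] := laurent_inv (laurentE l).
  by move=> h; move/eqP: l0; apply; apply: val_inj.
by have [y' y'E] := mklaurent ly; exists y'; apply: val_inj; rewrite /= y'E.
Qed.

Lemma laurent_invr0 : laurent_invr 0 = 0.
Proof.
by rewrite /laurent_invr; case: xgetP => // y _ /eqP; rewrite mulr0 eq_sym oner_eq0.
Qed.

HB.instance Definition _ := GRing.ComNzRing_isField.Build laurent
  laurent_mulVf laurent_invr0.

(* A synonym of lval, whose ring morphism structure is found by unification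
   (that of val is not). *)
Definition lemb (l : laurent) : hahn K := lval l.

Lemma lemb_is_zmod_morphism : zmod_morphism lemb.
Proof. by []. Qed.
Lemma lemb_is_monoid_morphism : monoid_morphism lemb.
Proof. by []. Qed.
HB.instance Definition _ := GRing.isZmodMorphism.Build laurent (hahn K) lemb
  lemb_is_zmod_morphism.
HB.instance Definition _ := GRing.isMonoidMorphism.Build laurent (hahn K) lemb
  lemb_is_monoid_morphism.

Lemma lemb_inj : injective lemb.
Proof. exact: val_inj. Qed.

Lemma lemb_laurent l : is_laurent (lemb l).
Proof. exact: laurentE. Qed.

Lemma laurent_lemb x : is_laurent x -> exists l, lemb l = x.
Proof. exact: mklaurent. Qed.

End Laurent.
Arguments lemb {K} l : simpl never.

(** * Frobenius and rescaling of exponents *)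

Section Frobenius.
Variables (K : fieldType) (p : nat).
Hypothesis hchar : p \in [pchar K].
Implicit Types x y z : hahn K.

Lemma restr_wo (P : pred rat) x : well_ordered_support (fun q => if P q then x q else 0).
Proof.
apply: (@wo_sub _ [set q | x q != 0]); last exact: hahnP.
by move=> q /=; case: (P q) => //; rewrite eqxx.
Qed.

Definition hrestr P x : hahn K := Hahn (@restr_wo P x).

Lemma hcoefMn x n q : (x *+ n) q = x q *+ n.
Proof. by elim: n => [//|n IHn]; rewrite !mulrS hcoefD IHn. Qed.

Lemma hahn_char : p \in [pchar (hahn K)].
Proof.
have [pp p0] := andP hchar; apply/andP; split=> //; apply/eqP.
apply: hahn_eq => q; rewrite hcoefMn hcoef1 hcoef0.
by case: (q == 0); rewrite ?mul0rn // (eqP p0).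
Qed.

Lemma hmonoX a (c : K) n : hmono a c ^+ n = hmono (n%:R * a) (c ^+ n).
Proof.
elim: n => [|n IHn]; first by apply: hahn_eq => q; rewrite hcoef1 /= mul0r.
apply: hahn_eq => q; rewrite exprS hmonoM IHn /= subr_eq.
by rewrite -natr1 mulrDl mul1r; case: ifP; rewrite ?mulr0 // exprS.
Qed.

Lemma coefX_lt x s n e : (forall u, x u != 0 -> u < s) ->
  (x ^+ n.+1) e != 0 -> e < n.+1%:R * s.
Proof.
move=> xs; elim: n e => [|n IHn] e; first by rewrite expr1 mul1r; apply: xs.
rewrite exprS => /coefM_neq0[u [/xs us /IHn es]].
by rewrite -natr1 mulrDl mul1r -(subrK u e) ltrD.
Qed.

Lemma coefX_gt x s n e : (forall u, x u != 0 -> s < u) ->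
  (x ^+ n.+1) e != 0 -> n.+1%:R * s < e.
Proof.
move=> xs; elim: n e => [|n IHn] e; first by rewrite expr1 mul1r; apply: xs.
rewrite exprS => /coefM_neq0[u [/xs us /IHn es]].
by rewrite -natr1 mulrDl mul1r -(subrK u e) ltrD.
Qed.

(* Split x at the exponent q / p: by additivity of Frobenius the p-th powers of
   the lower and upper parts do not meet the exponent q. *)
Lemma hcoef_pX x q : (x ^+ p) q = (x (q / p%:R)) ^+ p.
Proof.
have [pp _] := andP hchar; have p0 := prime_gt0 pp.
have pR : p%:R != 0 :> rat by rewrite pnatr_eq0 -lt0n.
pose s := q / p%:R; have sq : p%:R * s = q by rewrite /s mulrC divfK.
have xE : x = hrestr (fun u => u < s) x + hmono s (x s) + hrestr (fun u => s < u) x.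
  apply: hahn_eq => u; rewrite !hcoefD /=.
  by case: ltgtP => [||->]; rewrite ?addr0 ?add0r.
rewrite {1}xE -(pFrobenius_autE hahn_char) !rmorphD /= !pFrobenius_autE.
rewrite hmonoX sq /= eqxx.
have lt0 : (hrestr (fun u => u < s) x ^+ p) q = 0.
  apply: contrapT => /eqP; rewrite -{1}(prednK p0) => /(@coefX_lt _ s) h.
  have : q < p.-1.+1%:R * s by apply: h => u /=; case: ifP => //; rewrite eqxx.
  by rewrite prednK // sq ltxx.
have gt0 : (hrestr (fun u => s < u) x ^+ p) q = 0.
  apply: contrapT => /eqP; rewrite -{1}(prednK p0) => /(@coefX_gt _ s) h.
  have : p.-1.+1%:R * s < q by apply: h => u /=; case: ifP => //; rewrite eqxx.
  by rewrite prednK // sq ltxx.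
by rewrite lt0 gt0 add0r addr0.
Qed.

Lemma hcoef_pXn x i q : (x ^+ (p ^ i)) q = (x (q / (p ^ i)%:R)) ^+ (p ^ i).
Proof.
elim: i q => [|i IHi] q; first by rewrite expn0 !expr1 divr1.
by rewrite expnSr exprM hcoef_pX IHi -exprM; congr (x _ ^+ _); rewrite natrM invfM mulrA mulrAC.
Qed.

End Frobenius.

Section Scale.
Variable K : fieldType.
Implicit Types x y z : hahn K.

Lemma scale_wo (a : nat) x : well_ordered_support (fun q => x (q / a.+1%:R)).
Proof.
apply: (@wo_inj _ [set q | x q != 0] (fun q => q / a.+1%:R)) => //.
  by move=> u v; rewrite ler_pM2r // invr_gt0 ltr0Sn.
exact: hahnP.
Qed.

(* The substitution t |-> t^(a+1); the shift by one spares a positivity hypothesis. *)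
Definition hscale a x : hahn K := Hahn (@scale_wo a x).

Lemma hscaleE a x q : hscale a x q = x (q / a.+1%:R). Proof. by []. Qed.

Lemma hscale0 a : hscale a 0 = 0. Proof. by apply: hahn_eq => q. Qed.

Lemma hscaleD a x y : hscale a (x + y) = hscale a x + hscale a y.
Proof. by apply: hahn_eq => q. Qed.

Lemma hscaleN a x : hscale a (- x) = - hscale a x.
Proof. by apply: hahn_eq => q. Qed.

Lemma hscale_sum a (I : Type) (r : seq I) (P : pred I) (F : I -> hahn K) :
  hscale a (\sum_(i <- r | P i) F i) = \sum_(i <- r | P i) hscale a (F i).
Proof.
by elim/big_rec2: _ => [|i u v _ <-]; [exact: hscale0 | exact: hscaleD].
Qed.

Lemma hscale_inj a x y : hscale a x = hscale a y -> x = y.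
Proof.
move=> xy; apply: hahn_eq => q.
have := congr1 (fun z : hahn K => z (q * a.+1%:R)) xy.
by rewrite /= mulfK // pnatr_eq0.
Qed.

Lemma hscaleM a x y : hscale a (x * y) = hscale a x * hscale a y.
Proof.
apply: hahn_eq => q; rewrite hscaleE.
have [s us sP] := hmul_dom (q / a.+1%:R) (hahnP x) (hahnP y).
have a0 : a.+1%:R != 0 :> rat by rewrite pnatr_eq0.
rewrite (hmul_seqP us sP) (@hmul_seqP _ _ _ _ [seq u * a.+1%:R | u <- s]).
- by rewrite big_map; apply: eq_bigr => u _; rewrite !hscaleE mulrBl mulfK.
- by rewrite map_inj_uniq // => u v; apply: mulIf.
- move=> u xu yu; apply/mapP; exists (u / a.+1%:R); last by rewrite divfK.
  by apply: sP; rewrite // -mulrBl.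
Qed.

Lemma hscale1 a : hscale a 1 = 1.
Proof.
apply: hahn_eq => q; rewrite hscaleE !hcoef1.
by rewrite mulf_eq0 invr_eq0 pnatr_eq0 orbF.
Qed.

Lemma hscaleX a x n : hscale a (x ^+ n) = hscale a x ^+ n.
Proof. by elim: n => [|n IHn]; [exact: hscale1 | rewrite !exprS hscaleM IHn]. Qed.

Lemma hscale_comp a b x : hscale a (hscale b x) = hscale ((a.+1 * b.+1).-1) x.
Proof.
apply: hahn_eq => q; rewrite !hscaleE prednK ?muln_gt0 // natrM invfM.
by rewrite mulrA.
Qed.

Lemma hscale_laurent a x : is_laurent x -> is_laurent (hscale a x).
Proof.
move=> [k xk]; exists (k * a.+1%:Z) => q /xk[n qn kn].
exists (n * a.+1%:Z); last by rewrite ler_pM2r.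
by rewrite rmorphM /= -qn divfK // pnatr_eq0.
Qed.

End Scale.

(** * Integrality and linear dependence of Frobenius powers *)

Section Integral.
Variables (K : fieldType) (p : nat).
Hypothesis hchar : p \in [pchar K].

(** Laurent series form a field, so dividing by the leading coefficient makes any nonzero polynomial
    monic. *)
Lemma integral_polyP (x : hahn K) : integral_over_laurent x <->
  exists2 Q : {poly laurent K}, Q != 0 & (map_poly (@lemb K) Q).[x] = 0.
Proof.
split=> [[n [A [Al xA]]]|[Q Q0 Qx]].
  have exl i : exists l : laurent K, (i < n)%N -> hcoef (lemb l) = A i.
    have [ilt|_] := boolP (i < n)%N; last by exists 0.
    have [l lE] := @laurent_lemb K (Hahn (laurent_wo (Al i ilt))) (Al i ilt).
    by exists l => _; rewrite lE.
  have [l lP] := choice exl.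
  exists ('X^n + \poly_(i < n) l i).
    apply/eqP => /(congr1 (fun P : {poly laurent K} => P`_n)) /eqP.
    by rewrite coefD coefXn eqxx coef_poly ltnn addr0 coef0 oner_eq0.
  rewrite rmorphD /= map_polyXn hornerD hornerXn poly_def rmorph_sum horner_sum.
  apply: hahn_eq => e; rewrite hcoefD hcoef_sum hcoefX -[RHS](xA e).
  congr (_ + _); apply: eq_bigr => i _.
  rewrite /= map_polyZ hornerZ map_polyXn hornerXn hcoefM hcoefX.
  by rewrite -lP //.
pose n := (size Q).-1; have sQ : size Q = n.+1 by rewrite prednK // lt0n size_poly_eq0.
exists n, (fun i => hcoef (lemb ((lead_coef Q)^-1 * Q`_i))); split.
  by move=> i _; apply: lemb_laurent.
move=> e; rewrite -hcoefX.
under eq_bigr => i _ do rewrite -hcoefX -hcoefM.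
rewrite -hcoef_sum -hcoefD.
suff -> : x ^+ n + \sum_(i < n) lemb ((lead_coef Q)^-1 * Q`_i) * x ^+ i = 0 by [].
have lQ : lead_coef Q != 0 by rewrite lead_coef_eq0.
transitivity (lemb (lead_coef Q)^-1 * (map_poly (@lemb K) Q).[x]); last by rewrite Qx mulr0.
rewrite horner_coef size_map_poly_id0; last first.
  by apply/eqP => h; move/eqP: lQ; apply; apply: lemb_inj.
rewrite sQ big_ord_recr /= mulrDr addrC; congr (_ + _).
  rewrite big_distrr; apply: eq_bigr => i _ /=.
  by rewrite coef_map rmorphM /= mulrA.
rewrite coef_map /= mulrA -rmorphM /= mulVf //.
by rewrite rmorph1 mul1r.
Qed.

Lemma row_dep (F : fieldType) m n (M : 'M[F]_(m, n)) : (n < m)%N ->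
  exists2 v : 'rV_m, v != 0 & v *m M = 0.
Proof.
move=> nm; have /rowV0Pn[v /sub_kermxP vM v0] : kermx M != 0.
  rewrite -mxrank_eq0 mxrank_ker subn_eq0 -ltnNge.
  exact: leq_ltn_trans (rank_leq_col M) nm.
by exists v.
Qed.

(* Ore: the remainders of X^(p^i) modulo Q are linearly dependent. *)
Lemma integral_additive (x : hahn K) : integral_over_laurent x ->
  exists (n : nat) (A : 'I_n -> laurent K),
    (exists i, A i != 0) /\ \sum_(i < n) lemb (A i) * x ^+ (p ^ i) = 0.
Proof.
move=> /integral_polyP[Q Q0 Qx].
have [v v0 vM] := @row_dep (laurent K) (size Q).+1 (size Q)
  (\matrix_(i, j) ('X^(p ^ i) %% Q)`_j) (ltnSn _).
exists (size Q).+1, (fun i => v 0 i); split.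
  by case/rV0Pn: v0 => i vi; exists i.
transitivity ((map_poly (@lemb K) (\sum_(i < (size Q).+1) v 0 i *: 'X^(p ^ i))).[x]).
  rewrite rmorph_sum horner_sum; apply: eq_bigr => i _.
  by rewrite /= map_polyZ hornerZ map_polyXn hornerXn.
have -> : \sum_(i < (size Q).+1) v 0 i *: 'X^(p ^ i) =
    (\sum_(i < (size Q).+1) v 0 i *: ('X^(p ^ i) %/ Q)) * Q.
  rewrite big_distrl /=.
  under eq_bigr => i _ do rewrite (divp_eq 'X^(p ^ i) Q) scalerDr scalerAl.
  rewrite big_split /= [X in _ + X](_ : _ = 0) ?addr0 //.
  apply/polyP => j; rewrite coef0 coef_sum.
  have [jQ|Qj] := ltnP j (size Q); last first.
    rewrite big1 // => i _; rewrite coefZ nth_default ?mulr0 //.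
    by apply: leq_trans Qj; apply/ltnW; rewrite ltn_modp.
  have := congr1 (fun M : 'rV_(size Q) => M 0 (Ordinal jQ)) vM.
  rewrite !mxE => vMj; rewrite -[RHS]vMj; apply: eq_bigr => i _.
  by rewrite coefZ !mxE.
by rewrite rmorphM hornerM Qx mulr0.
Qed.

End Integral.

(** * Digit strings *)

Lemma sumn_eq0 (w : seq nat) : sumn w = 0%N -> w = nseq (size w) 0%N.
Proof. by elim: w => [//|d w IHw] /= /eqP; rewrite addn_eq0 => /andP[/eqP-> /eqP/IHw<-]. Qed.

(** Of [c.+1] disjoint blocks of length [R], at most [c] contain a nonzero digit. *)
Lemma zero_run R c (w : seq nat) : (sumn w <= c)%N -> (c.+1 * R <= size w)%N ->
  exists u v, w = u ++ nseq R 0%N ++ v.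
Proof.
elim: c w => [|c IHc] w wc Rw; have sR : size (take R w) = R by rewrite size_takel; nia.
  exists [::], (drop R w); rewrite /= -{1}(cat_take_drop R w); congr (_ ++ _).
  rewrite -[in RHS]sR; apply: sumn_eq0.
  by move: wc; rewrite -{1}(cat_take_drop R w) sumn_cat; lia.
have [t0|t0] := posnP (sumn (take R w)).
  exists [::], (drop R w); rewrite /= -{1}(cat_take_drop R w); congr (_ ++ _).
  by rewrite -[in RHS]sR; apply: sumn_eq0.
have [||u [v uv]] := IHc (drop R w).
- by move: wc; rewrite -{1}(cat_take_drop R w) sumn_cat; lia.
- by rewrite size_drop; nia.
by exists (take R w ++ u), v; rewrite -catA -uv cat_take_drop.
Qed.

Section Digits.
Variable p : nat.
Hypothesis p_gt1 : (1 < p)%N.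
Implicit Types u v w : seq nat.

(** Horner form of [digval], suited to moving one digit at a time across the radix point. *)
Fixpoint dv w : rat := if w is d :: w' then (d%:R + dv w') / p%:R else 0.

Notation dg := (all (fun d => d < p)%N).
Notation zeros n := (nseq n 0%N).

Let pN0 : p%:R != 0 :> rat. Proof. by rewrite pnatr_eq0; case: p p_gt1. Qed.

Lemma digvalE w : digval p w = dv w.
Proof.
rewrite /digval; elim: w => [|d w IHw]; first by rewrite big_ord0.
rewrite /= big_ord_recl /= expr1 -IHw mulrDl; congr (_ + _).
rewrite big_distrl; apply: eq_bigr => i _ /=.
by rewrite exprS invfM mulrAC mulrA.
Qed.

Lemma dv_zeros n w : dv (zeros n ++ w) = dv w / p%:R ^+ n.
Proof.
elim: n => [|n IHn]; first by rewrite expr0 divr1.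
by rewrite /= IHn add0r exprSr invfM mulrA.
Qed.

Lemma dv_all0 n : dv (zeros n) = 0.
Proof. by rewrite -[zeros n]cats0 dv_zeros mul0r. Qed.

Lemma dv_cat_zeros w n : dv (w ++ zeros n) = dv w.
Proof. by elim: w => [|d w IHw] /=; [exact: dv_all0 | rewrite IHw]. Qed.

Lemma dv_cat u v : dv (u ++ v) = dv u + dv v / p%:R ^+ size u.
Proof.
elim: u => [|d u IHu]; first by rewrite /= expr0 divr1 add0r.
by rewrite /= IHu addrA mulrDl exprSr invfM mulrA.
Qed.

Lemma dv_take k w : \sum_(i < size w | (i < k)%N) (nth 0%N w i)%:R * (p%:R ^- i.+1) =
  dv (take k w).
Proof.
elim: w k => [|d w IHw] k; first by rewrite big_ord0.
rewrite big_mkcond big_ord_recl /=; case: k => [|k] /=.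
  by rewrite big1 ?addr0.
rewrite expr1 -IHw mulrDl; congr (_ + _).
rewrite big_distrl [RHS]big_mkcond; apply: eq_bigr => i _ /=.
by rewrite /bump /= add1n ltnS exprS invfM; case: ifP; rewrite ?mulrA // mulrAC.
Qed.

(** Dividing the tail by p^n inserts [n] zeros after the first [j.-1] digits; the sequences of the
    theorem thus become widening gaps in a digit string. *)
Lemma shifted_pointE w j n : (0 < j)%N -> shifted_point p w j n =
  - dv (take j.-1 w ++ zeros n ++ drop j.-1 w).
Proof.
case: j => [//|k] _ /=; rewrite /shifted_point !dv_cat size_nseq dv_all0 add0r.
under eq_bigl => i do rewrite ltnS.
rewrite dv_take opprD; congr (_ - _).
have := digvalE w; rewrite /digval (bigID (fun i : 'I__ => (i < k)%N)) /= dv_take.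
have -> : dv w = dv (take k w) + dv (drop k w) / p%:R ^+ size (take k w).
  by rewrite -dv_cat cat_take_drop.
move=> /addrI e.
under eq_bigl => i do rewrite ltnS leqNgt.
by rewrite e mulrC mulrAC.
Qed.

Lemma dv_ge0 w : 0 <= dv w.
Proof.
by elim: w => [//|d w IHw] /=; rewrite divr_ge0 ?addr_ge0.
Qed.

Lemma dv_lt1 w : dg w -> dv w < 1.
Proof.
elim: w => [//|d w IHw] /= /andP[dp /IHw wlt]; rewrite ltr_pdivrMr ?ltr0n ?(ltnW p_gt1) // mul1r.
apply: lt_le_trans (_ : d%:R + 1 <= _); first by rewrite ltrD2l.
by rewrite natr1 ler_nat.
Qed.

Lemma dv_eq0 w : dv w = 0 -> sumn w = 0%N.
Proof.
elim: w => [//|d w IHw] /= /eqP; rewrite mulf_eq0 invr_eq0 (negPf pN0) orbF.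
rewrite paddr_eq0 ?dv_ge0 // pnatr_eq0 => /andP[/eqP-> /eqP/IHw->]; by [].
Qed.

(** Digit values lie in [0, 1), so the integer part is the ceiling of the exponent. *)
Lemma int_digits_uniq (m m' : int) u v : dg u -> dg v ->
  m%:~R - dv u = m'%:~R - dv v -> m = m' /\ dv u = dv v.
Proof.
move=> du dw e; have [u0 v0] := (dv_ge0 u, dv_ge0 v).
have [u1 v1] := (dv_lt1 du, dv_lt1 dw).
have mm : m = m'.
  have : (m - m')%:~R < 1%:~R :> rat by rewrite rmorphB /=; lra.
  have : (m' - m)%:~R < 1%:~R :> rat by rewrite rmorphB /=; lra.
  by rewrite !ltr_int; lia.
by split=> //; move: e; rewrite mm => /addrI/oppr_inj.
Qed.

(** The strings may differ by trailing zeros, hence a conclusion about digit sums only. Multiplying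
    by -p turns the leading digit into an integer part. *)
Lemma dv_sum_uniq u v : dg u -> dg v -> dv u = dv v -> sumn u = sumn v.
Proof.
elim: u v => [|d u IHu] [|d' v] //.
- by move=> _ _ e; rewrite (dv_eq0 (w := d' :: v)).
- by move=> _ _ e; rewrite (dv_eq0 (w := d :: u)).
move=> /= /andP[dp du] /andP[d'p dv'] /(mulIf (invr_neq0 pN0)) e.
have [|dd uv] := @int_digits_uniq (- d%:Z) (- d'%:Z) u v du dv'.
  by rewrite !rmorphN /= -!opprD -!pmulrn e.
by rewrite (IHu v) //; congr (_ + _)%N; lia.
Qed.

(** Division with the quotient rounded up, since exponents are an integer minus a digit value. *)
Lemma digit_step (m : int) : exists (m' : int) (d : nat),
  (d < p)%N /\ m = p%:Z * m' - d%:Z.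
Proof.
have p0 : p%:Z != 0 by lia.
exists (- ((- m) %/ p%:Z)%Z), `|((- m) %% p%:Z)%Z|%N.
have := divz_eq (- m) p%:Z; have := modz_ge0 (- m) p0.
have := @ltz_pmod (- m) p%:Z; lia.
Qed.

Lemma digit_stepE (m' : int) (d : nat) w :
  ((p%:Z * m' - d%:Z)%:~R - dv w) / p%:R = m'%:~R - dv (d :: w).
Proof.
rewrite /= rmorphB rmorphM /= -!pmulrn !mulrDl !mulNr mulrC mulKf //.
by rewrite opprD addrA.
Qed.

Lemma digit_shiftE (m : int) (d : nat) w :
  p%:R * (m%:~R - dv (d :: w)) = (p%:Z * m - d%:Z)%:~R - dv w.
Proof. by rewrite -digit_stepE mulrC divfK. Qed.

End Digits.

(** * Series with bounded digit sums and periodic coefficients *)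

Section Good.
Variables (K : fieldType) (p : nat).
Hypothesis p_pr : prime p.
Implicit Types (x y z : hahn K) (u v w : seq nat).

Notation dg := (all (fun d => d < p)%N).
Notation zeros n := (nseq n 0%N).
Notation dv := (dv p).

Let p_gt1 : (1 < p)%N := prime_gt1 p_pr.

Definition digit_supp c (b : nat) x := forall q, x q != 0 ->
  exists (n : int) w, [/\ - b%:Z <= n, digits_ok p c w & q = n%:~R - dv w].

(** With [m] and the digit sums unbounded, stability under sums and integer shifts is immediate; for
    a series satisfying [digit_supp], both sides vanish outside the bounds. *)
Definition gap_periodic M N x := forall (m : int) u v n, dg u -> dg v -> (M <= n)%N ->
  x (m%:~R - dv (u ++ zeros (n + N) ++ v)) = x (m%:~R - dv (u ++ zeros n ++ v)).

(** The bound [b] is hidden because p-th powers and Laurent multipliers may change it, while [c],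
    [M], [N] stay fixed. *)
Definition good c M N x := (exists b, digit_supp c b x) /\ gap_periodic M N x.

Lemma dg_zeros n : dg (zeros n).
Proof. by rewrite all_nseq ltnW ?orbT. Qed.

Lemma dg_ins u v n : dg u -> dg v -> dg (u ++ zeros n ++ v).
Proof. by move=> du dw; rewrite !all_cat du dg_zeros. Qed.

Lemma sum_ins u v n : sumn (u ++ zeros n ++ v) = (sumn u + sumn v)%N.
Proof. by rewrite !sumn_cat sumn_nseq mul0n. Qed.

Lemma digit_supp_sum c b x (m : int) w : digit_supp c b x -> dg w ->
  x (m%:~R - dv w) != 0 -> - b%:Z <= m /\ (sumn w <= c)%N.
Proof.
move=> sx dw /sx[n [w' [bn /andP[dw' sw'] e]]].
have [-> dvE] := int_digits_uniq p_gt1 dw dw' e; split=> //.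
by rewrite (dv_sum_uniq p_gt1 dw dw' dvE).
Qed.

(** Widening the gap changes neither [m] nor the digit sum, so outside the bounds all coefficients
    concerned are 0. *)
Lemma gap_periodicP c b M N x : digit_supp c b x ->
  (forall (m : int) u v n, - b%:Z <= m -> digits_ok p c (u ++ v) -> (M <= n)%N ->
    x (m%:~R - dv (u ++ zeros (n + N) ++ v)) = x (m%:~R - dv (u ++ zeros n ++ v))) ->
  gap_periodic M N x.
Proof.
move=> sx px m u v n du dw Mn.
have [|out] := boolP ((- b%:Z <= m) && (sumn u + sumn v <= c)%N).
  move=> /andP[bm sc]; apply: px => //.
  by rewrite /digits_ok all_cat du dw sumn_cat.
have zero k : x (m%:~R - dv (u ++ zeros k ++ v)) = 0.
  apply: contrapT => /eqP /(digit_supp_sum sx (dg_ins k du dw))[bm].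
  by rewrite sum_ins => sc; rewrite bm sc in out.
by rewrite !zero.
Qed.

Lemma gap_periodic_mul M N k x : gap_periodic M N x -> gap_periodic M (k * N) x.
Proof.
move=> px m u v n du dw Mn; elim: k => [|k IHk]; first by rewrite addn0.
by rewrite mulSnr addnA px // (leq_trans Mn) ?leq_addr.
Qed.

Lemma good0 c M N : good c M N 0.
Proof. by split=> [|//]; exists 0%N => q; rewrite hcoef0 eqxx. Qed.

Lemma goodD c M N x y : good c M N x -> good c M N y -> good c M N (x + y).
Proof.
move=> [[b sx] px] [[b' sy] py]; split; last first.
  by move=> m u v n du dw Mn; rewrite !hcoefD px ?py.
exists (b + b')%N => q; rewrite hcoefD; have [->|x0 _] := eqVneq (x q) 0.
  by rewrite add0r => /sy[n [w [bn ok e]]]; exists n, w; split=> //; lia.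
by have [n [w [bn ok e]]] := sx _ x0; exists n, w; split=> //; lia.
Qed.

Lemma good_sum c M N (I : Type) (r : seq I) (P : pred I) (F : I -> hahn K) :
  (forall i, P i -> good c M N (F i)) -> good c M N (\sum_(i <- r | P i) F i).
Proof. by move=> h; apply: big_ind => //; [exact: good0 | exact: goodD]. Qed.

Lemma coefM_congr (l y : hahn K) e e' :
  (forall r, l r != 0 -> y (e - r) = y (e' - r)) -> (l * y) e = (l * y) e'.
Proof.
move=> ye; have [s us sP] := hmul_dom e (hahnP l) (hahnP y).
rewrite !(@hmul_seqP _ _ _ _ s) //.
  apply: eq_bigr => u _; have [->|/ye->//] := eqVneq (l u) 0.
  by rewrite !mul0r.
by move=> u lu yu; apply: sP; rewrite // ye.
Qed.

(** A Laurent multiplier shifts exponents by integers and leaves digit strings untouched. *)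
Lemma goodM c M N (l : laurent K) x : good c M N x -> good c M N (lemb l * x).
Proof.
move=> [[b sx] px]; have [k lk] := lemb_laurent l; split.
  exists (b + `|k|)%N => q /coefM_neq0[u [/lk[n -> kn] /sx[m [w [bm ok e]]]]].
  exists (n + m), w; split=> //; first lia.
  by rewrite rmorphD /= -addrA -e addrC subrK.
move=> m u v n du dw Mn; apply: coefM_congr => r /lk[i -> _].
have e w : m%:~R - dv w - i%:~R = (m - i)%:~R - dv w by rewrite rmorphB /= addrAC.
by rewrite !e px.
Qed.

(** A string of this length and digit sum at most [c] has [M + N] consecutive zeros; periodicity
    allows removing [N] of them. *)
Definition short_len c M N := (c.+1 * (M + N))%N.

Lemma short_string c M N x : (0 < N)%N -> gap_periodic M N x ->
  forall (m : int) w, digits_ok p c w -> exists2 w',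
    dg w' /\ (size w' <= short_len c M N)%N & x (m%:~R - dv w) = x (m%:~R - dv w').
Proof.
move=> N0 px m w; elim: (size w) {-2}w (leqnn (size w)) => {w} [|s IHs] w.
  by case: w => // _ /andP[dw _]; exists [::].
move=> ws /andP[dw sw].
have [short|long] := leqP (size w) (short_len c M N); first by exists w.
have [u [v wE]] := zero_run sw (ltnW long).
have [du dw'] : dg u /\ dg v by move: dw; rewrite wE !all_cat => /and3P[].
have [||w' w'P xw'] := IHs (u ++ zeros M ++ v).
- by move: ws; rewrite wE !size_cat !size_nseq; lia.
- by rewrite /digits_ok dg_ins //; move: sw; rewrite wE !sum_ins.
by exists w'; rewrite // -xw' wE px.
Qed.

Lemma good_eq0 c M N x : (0 < N)%N -> good c M N x ->
  (forall (m : int) w, dg w -> (size w <= short_len c M N)%N -> x (m%:~R - dv w) = 0) ->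
  x = 0.
Proof.
move=> N0 [[b sx] px] x0; apply: hahn_eq => q; rewrite hcoef0; apply: contrapT => /eqP xq.
have [m [w [_ ok qE]]] := sx _ xq; move/eqP: (xq); apply; rewrite qE.
by have [w' [dw' sw'] ->] := short_string N0 px m ok; apply: x0.
Qed.

(* The series sum_n x_(n+q) t^n. *)
Lemma slice_laurent q x :
  is_laurent (fun e => if e == (numq e)%:~R then x (e + q) else 0).
Proof.
have [[r xr]|none] := pselect (exists r, x r != 0); last first.
  by exists 0 => e; case: ifP => [_ xe|_]; [case: none; exists (e + q) | rewrite eqxx].
have [||m xm mle] := hahnP x [set r | x r != 0]; first by [].
  by exists r.
exists (Num.floor (m - q)) => e; case: ifP => [/eqP eE xe|_]; last by rewrite eqxx.
exists (numq e) => //; rewrite -(ler_int rat) -eE.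
apply: le_trans (Num.Theory.ge_floor _) _; by rewrite lerBlDr; apply: mle.
Qed.

Definition slice q x : hahn K := Hahn (laurent_wo (@slice_laurent q x)).

Lemma slice_int q x (n : int) : slice q x n%:~R = x (n%:~R + q).
Proof. by rewrite /= numq_int eqxx. Qed.

Lemma slice_sum q (I : Type) (r : seq I) (P : pred I) (F : I -> hahn K) :
  slice q (\sum_(i <- r | P i) F i) = \sum_(i <- r | P i) slice q (F i).
Proof.
apply: hahn_eq => e; rewrite hcoef_sum /=; case: ifP => _; last by rewrite big1.
by rewrite hcoef_sum.
Qed.

(** The exponents of [l] are integers, so classes modulo 1 are not mixed. *)
Lemma slice_lmul q (l : laurent K) x : slice q (lemb l * x) = lemb l * slice q x.
Proof.
have [k lk] := lemb_laurent l.
apply: hahn_eq => e; have [[n ->]|nint] := pselect (exists n : int, e = n%:~R); last first.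
  have slice0 y r : (forall n : int, r <> n%:~R) -> slice q y r = 0.
    by move=> rint /=; case: ifP => // /eqP/rint.
  rewrite slice0 => [|n en]; last by apply: nint; exists n.
  apply/esym; apply: contrapT => /eqP/coefM_neq0[r [/lk[i -> _]]].
  rewrite slice0 ?eqxx // => n en; apply: nint; exists (n + i).
  by rewrite rmorphD /= -en subrK.
rewrite slice_int.
have [s us sP] := hmul_dom (n%:~R + q) (hahnP (lemb l)) (hahnP x).
have sl i : lemb l i != 0 -> slice q x (n%:~R - i) = x (n%:~R + q - i).
  by move=> /lk[j -> _]; rewrite -rmorphB slice_int rmorphB /= addrAC.
rewrite !(@hmul_seqP _ _ _ _ s) //.
  apply: eq_bigr => i _; have [->|/sl->//] := eqVneq (lemb l i) 0.
  by rewrite !mul0r.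
by move=> i li; rewrite sl //; apply: sP.
Qed.

Hypothesis hchar : p \in [pchar K].

(** The coefficient of [x ^+ p] at an exponent comes from that of [x] at the exponent divided by p;
    this division prepends one digit and keeps the gap. *)
Lemma good_pX c M N x : good c M N x -> good c M N (x ^+ p).
Proof.
move=> [[b sx] px]; split; last first.
  move=> m u v n du dw Mn; rewrite !(hcoef_pX hchar).
  have [m' [d [dp ->]]] := digit_step p_gt1 m.
  rewrite !(digit_stepE p_gt1) -!cat_cons px //=; by rewrite dp.
(* The integer part is multiplied by p and then loses a digit less than p. *)
exists (p * b + p)%N => q; rewrite (hcoef_pX hchar) expf_eq0 negb_and.
rewrite prime_gt0 //= => /sx[n [w [bn ok e]]].
have qE : q = p%:R * (n%:~R - dv w).
  by rewrite -e mulrC divfK // pnatr_eq0 -lt0n prime_gt0.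
case: w ok e qE => [|d w] /andP[dw sw] e ->.
  exists (p%:Z * n), [::]; split=> //; first nia.
  by rewrite /= !subr0 rmorphM.
move: dw sw => /= /andP[dp dw] sw.
exists (p%:Z * n - d%:Z), w; split; first nia.
  by rewrite /digits_ok dw (leq_trans _ sw) ?leq_addl.
by rewrite (digit_shiftE p_gt1).
Qed.

Lemma good_pXn c M N x i : good c M N x -> good c M N (x ^+ (p ^ i)).
Proof.
move=> gx; elim: i => [|i IHi]; first by rewrite expr1.
by rewrite expnSr exprM; apply: good_pX.
Qed.

(** Slices at the finitely many points of [T] are linear over the Laurent field. With one more power
    [x ^+ (p ^ i)] than slices, some nontrivial combination has all slices 0 and vanishes by
    [good_eq0]. *)
Lemma good_integral c M N a x : (0 < N)%N -> good c M N (hscale a x) ->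
  integral_over_laurent x.
Proof.
move=> N0 gx; apply/integral_polyP.
pose B := short_len c M N.
pose T := ('I_a.+1 * B.-tuple 'I_p)%type.
pose pt (t : T) : rat := (t.1%:R - dv (map val (tval t.2))) / a.+1%:R.
have slL q y : exists l, lemb l = slice q y by apply: laurent_lemb; exact: slice_laurent.
pose sl q y := sval (cid (slL q y)).
have slE q y : lemb (sl q y) = slice q y by apply: (svalP (cid (slL q y))).
have [v v0 vM] := @row_dep (laurent K) #|{: T}|.+1 #|{: T}|
  (\matrix_(i, j) sl (pt (enum_val j)) (x ^+ (p ^ i))) (ltnSn _).
exists (\sum_i v 0 i *: 'X^(p ^ i)).
  have /rV0Pn[i vi] := v0; apply: contraNneq vi => vX.
  have := congr1 (fun P : {poly laurent K} => P`_(p ^ i)) vX.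
  rewrite coef0 coef_sum (bigD1 i) //= coefZ coefXn eqxx mulr1 big1 ?addr0 => [->//|j ji].
  rewrite coefZ coefXn eqn_exp2l //; have /negPf -> : (val i != val j) by rewrite eq_sym.
  by rewrite mulr0.
pose y := \sum_i lemb (v 0 i) * x ^+ (p ^ i).
transitivity y.
  rewrite rmorph_sum horner_sum; apply: eq_bigr => i _.
  by rewrite /= map_polyZ hornerZ map_polyXn hornerXn.
have yslice t : slice (pt t) y = 0.
  have := congr1 (fun M : 'rV_ _ => M 0 (enum_rank t)) vM.
  rewrite !mxE => /(congr1 (@lemb K)); rewrite rmorph0 rmorph_sum /= => sl0.
  rewrite -[RHS]sl0 slice_sum; apply: eq_bigr => i _.
  by rewrite !mxE enum_rankK rmorphM /= slE slice_lmul.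
apply: (@hscale_inj _ a); rewrite hscale0; apply: (@good_eq0 c M N) => //.
  rewrite hscale_sum; apply: good_sum => i _; rewrite hscaleM hscaleX.
  have [l lE] : exists l, lemb l = hscale a (lemb (v 0 i)).
    by apply: laurent_lemb; apply: hscale_laurent; apply: lemb_laurent.
  by rewrite -lE; apply: goodM; apply: good_pXn.
move=> m w dw sw; rewrite hscaleE.
pose r := (m %% a.+1%:Z)%Z; pose n := (m %/ a.+1%:Z)%Z.
have r0 : 0 <= r by apply: modz_ge0.
have ra : (`|r| < a.+1)%N by have := @ltz_pmod m a.+1%:Z isT; rewrite -/r; lia.
(* Trailing zeros bring [w] to length exactly [B]. *)
have [t tE] : exists t : B.-tuple 'I_p, dv (map val (tval t)) = dv w.
  have wB : size (map (fun d => insubd (Ordinal (prime_gt0 p_pr)) d) (w ++ zeros (B - size w))) == B.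
    by rewrite size_map size_cat size_nseq subnKC.
  exists (Tuple wB); rewrite /= -map_comp -[RHS](dv_cat_zeros p w (B - size w)).
  rewrite map_id_in // => d dw' /=; rewrite val_insubd.
  suff -> : (d < p)%N by [].
  move: dw'; rewrite mem_cat => /orP[/(allP dw)//|/nseqP[-> _]]; exact: prime_gt0.
have -> : (m%:~R - dv w) / a.+1%:R = n%:~R + pt (Ordinal ra, t).
  have rE : r%:~R = `|r|%:R :> rat by rewrite -[in LHS](gez0_abs r0).
  rewrite /pt /= tE {1}(divz_eq m a.+1%:Z) -/r -/n rmorphD rmorphM /= rE.
  by rewrite -addrA mulrDl mulfK // pnatr_eq0.
by rewrite -slice_int yslice.
Qed.

End Good.

(** * Artin-Schreier equations *)

Section ArtinSchreier.
Variables (K : fieldType) (p : nat).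
Hypothesis p_pr : prime p.
Hypothesis hchar : p \in [pchar K].
Hypothesis halg : forall a : K, exists2 k : nat, (0 < k)%N & a ^+ (p ^ k) = a.

Notation dg := (all (fun d => d < p)%N).
Notation zeros n := (nseq n 0%N).
Notation dv := (dv p).

Let p_gt1 : (1 < p)%N := prime_gt1 p_pr.
Let pN0 : p%:R != 0 :> rat. Proof. by rewrite pnatr_eq0 -lt0n prime_gt0. Qed.

Lemma frobD (a b : K) k : (a + b) ^+ (p ^ k) = a ^+ (p ^ k) + b ^+ (p ^ k).
Proof.
elim: k => [|k IHk]; first by rewrite !expr1.
by rewrite expnSr !exprM IHk -!(pFrobenius_autE hchar) rmorphD.
Qed.

Lemma frob0 k : (0 : K) ^+ (p ^ k) = 0.
Proof. by rewrite expr0n eqn0Ngt expn_gt0 prime_gt0. Qed.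

Lemma frob_inj (a b : K) : a ^+ p = b ^+ p -> a = b.
Proof. by rewrite -!(pFrobenius_autE hchar) => /fmorph_inj. Qed.

Lemma frob_injX k (a b : K) : a ^+ (p ^ k) = b ^+ (p ^ k) -> a = b.
Proof.
elim: k => [|k IHk]; first by rewrite !expr1.
by rewrite expnSr !exprM => /frob_inj.
Qed.

Lemma frob_fixedM (a : K) r k : a ^+ (p ^ r) = a -> a ^+ (p ^ (k * r)) = a.
Proof.
by move=> ar; elim: k => [|k IHk]; [rewrite expr1 | rewrite mulSnr expnD exprM IHk].
Qed.

(** The exponents attached to the single elements are multiplied together. A multiple of [N] is
    wanted because the same number must also be a period of [g]. *)
Lemma frob_fixed_seq N (s : seq K) : (0 < N)%N -> exists2 k,
  (0 < k)%N & forall a, a \in s -> a ^+ (p ^ (k * N)) = a.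
Proof.
move=> N0; elim: s => [|a s [k k0 ks]]; first by exists 1%N.
have [l l0 al] := halg a; exists (l * k)%N; first by rewrite muln_gt0 l0.
move=> b; rewrite inE => /predU1P[->|/ks bs].
  by rewrite -mulnA mulnC; apply: frob_fixedM.
by rewrite -mulnA; apply: frob_fixedM.
Qed.

(** Iterating [r] times and using that [y] is fixed by the p^r-th power gives y_(j+r) = y_j + S_j
    with S of period [r]. After p such rounds the increment is p S_i = 0. *)
Lemma frob_recurrence_periodic (y h : nat -> K) r M :
  (forall i, y i.+1 ^+ p = y i + h i) ->
  (forall i, y i ^+ (p ^ r) = y i) ->
  (forall i, (M <= i)%N -> h (i + r)%N = h i) ->
  forall i, (M <= i)%N -> y (i + p * r)%N = y i.
Proof.
move=> yh yr hr i Mi; pose S i := \sum_(l < r) h (i + l)%N ^+ (p ^ l).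
have iterE k j : y (j + k)%N ^+ (p ^ k) = y j + \sum_(l < k) h (j + l)%N ^+ (p ^ l).
  elim: k => [|k IHk]; first by rewrite addn0 expr1 big_ord0 addr0.
  by rewrite addnS expnS exprM yh frobD IHk big_ord_recr addrA.
have yS j : y (j + r)%N = y j + S j by rewrite -iterE yr.
have SS j : (M <= j)%N -> S (j + r)%N = S j.
  by move=> Mj; apply: eq_bigr => l _; rewrite addnAC hr // (leq_trans Mj) ?leq_addr.
have SSm k : S (i + k * r)%N = S i.
  elim: k => [|k IHk]; first by rewrite addn0.
  by rewrite mulSnr addnA SS // (leq_trans Mi) ?leq_addr.
have step k : y (i + k * r)%N = y i + S i *+ k.
  elim: k => [|k IHk]; first by rewrite addn0 addr0.
  by rewrite mulSnr addnA yS IHk SSm mulrSr addrA.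
by rewrite step (mulrn_pchar hchar) addr0.
Qed.

(** The least support exponent on the sequence is also the last one. *)
Lemma decreasing_eventually0 (x : hahn K) (s : nat -> rat) :
  (forall k, s k.+1 < s k) -> exists k0, forall k, (k0 <= k)%N -> x (s k) = 0.
Proof.
move=> sdec; have smono i j : (i < j)%N -> s j < s i.
  elim: j => [//|j IHj]; rewrite ltnS leq_eqVlt => /orP[/eqP->//|/IHj].
  by apply: lt_trans.
have [[k xk]|none] := pselect (exists k, x (s k) != 0); last first.
  by exists 0%N => k _; apply: contrapT => /eqP xk; apply: none; exists k.
have [||_ [k1 [xk1 ->]] mle] :=
    hahnP x [set q | exists k, x (s k) != 0 /\ q = s k].
- by move=> q [j [xj ->]].
- by exists (s k), k.
exists k1.+1 => j kj; apply: contrapT => /eqP xj.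
have /mle : exists k, x (s k) != 0 /\ s j = s k by exists j.
by rewrite leNgt smono.
Qed.

Lemma pos_eventually0 (x : hahn K) q : 0 < q ->
  exists k0, forall k, (k0 <= k)%N -> x (q / p%:R ^+ k) = 0.
Proof.
move=> q0; apply: (decreasing_eventually0 x (s := fun k => q / p%:R ^+ k)) => k.
rewrite ltr_pM2l // exprSr invfM gtr_pMr ?invr_gt0 ?exprn_gt0 ?ltr0n ?prime_gt0 //.
by rewrite invf_lt1 ?ltr1n // ltr0n prime_gt0.
Qed.

Lemma neg_eventually0 (x : hahn K) q : q < 0 ->
  exists k0, forall k, (k0 <= k)%N -> x (p%:R ^+ k * q) = 0.
Proof.
move=> q0; apply: (decreasing_eventually0 x (s := fun k => p%:R ^+ k * q)) => k.
rewrite ltr_nM2r // exprSr ltr_pMr ?ltr1n //.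
by rewrite exprn_gt0 // ltr0n prime_gt0.
Qed.

(** For [m <= 0] the digits created are paid for by the integer part: digit sum plus |m'| is at most
    |m|. *)
Lemma div_digits k (m : int) : exists (m' : int) s,
  [/\ dg s, (m <= 0 -> m' <= 0 /\ (sumn s)%:Z - m' <= - m) &
   forall w, (m%:~R - dv w) / p%:R ^+ k = m'%:~R - dv (s ++ w)].
Proof.
elim: k m => [|k IHk] m.
  by exists m, [::]; split=> // [m0|w]; [split=> //=; lia | rewrite divr1].
have [m' [s [ds sm sE]]] := IHk m; have [m1 [d [dp mE]]] := digit_step p_gt1 m'.
exists m1, (d :: s); split=> /=; first by rewrite dp.
  move=> /sm[m'0 sm']; have m10 : m1 <= 0 by nia.
  have : p%:Z * m1 <= m1 by nia.
  by split=> //; lia.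
by move=> w; rewrite exprSr invfM mulrA sE mE (digit_stepE p_gt1).
Qed.

Lemma mul_digits k (m : int) u : (k <= size u)%N -> exists m' : int,
  forall w, p%:R ^+ k * (m%:~R - dv (u ++ w)) = m'%:~R - dv (drop k u ++ w).
Proof.
elim: k m u => [|k IHk] m u ku; first by exists m => w; rewrite mul1r drop0.
case: u ku => [//|d u] ku; have [m' m'E] := IHk (p%:Z * m - d%:Z) u ku.
by exists m' => w; rewrite exprSr -mulrA (digit_shiftE p_gt1) m'E.
Qed.

Lemma strings_finite B : exists l : seq (seq nat), forall w,
  dg w -> (size w <= B)%N -> w \in l.
Proof.
elim: B => [|B [l lP]]; first by exists [:: [::]] => w _; rewrite leqn0 => /nilP->.
exists ([::] :: [seq d :: w | d <- iota 0 p, w <- l]) => -[//|d w] /= /andP[dp dw] sw.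
by rewrite inE; apply/orP; right; apply: allpairs_f; [rewrite mem_iota | apply: lP].
Qed.

(** * A solution of $z^p - z = g$ for good $g$ *)

Section Solution.
Variables (c b M N : nat) (g z : hahn K).
Hypothesis N_gt0 : (0 < N)%N.
Hypothesis gsupp : digit_supp p c b g.
Hypothesis gper : gap_periodic p M N g.
Hypothesis zg : z ^+ p - z = g.

Let zgE q : z (q / p%:R) ^+ p = z q + g q.
Proof. by rewrite -zg hcoefD hcoefN (hcoef_pX hchar) addrC subrK. Qed.

Let zgN q : z q ^+ p = z (p%:R * q) + g (p%:R * q).
Proof. by rewrite -zgE mulrC mulKf. Qed.

(** Both [z (q / p%:R ^+ k)] and its analogue at [q'] vanish for large [k]; the recursion [zgE]
    leads from there back to [q] and [q'], so [g] on the orbits determines [z]. *)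
Lemma AS_pos_eq q q' : 0 < q -> 0 < q' ->
  (forall k, g (q / p%:R ^+ k) = g (q' / p%:R ^+ k)) -> z q = z q'.
Proof.
move=> q0 q'0 gq; have [k0 k0P] := pos_eventually0 z q0.
have [k1 k1P] := pos_eventually0 z q'0.
suff h i k : (i + k = k0 + k1)%N -> z (q / p%:R ^+ k) = z (q' / p%:R ^+ k).
  by have := h (k0 + k1)%N 0%N (addn0 _); rewrite !divr1.
elim: i k => [|i IHi] k; first by rewrite add0n => ->; rewrite k0P ?leq_addr // k1P ?leq_addl.
move=> ik; have /IHi : (i + k.+1 = k0 + k1)%N by lia.
rewrite !exprSr !invfM !mulrA => /(congr1 (fun a => a ^+ p)); rewrite !zgE gq.
by move/addIr.
Qed.

(** Here the orbit runs through [p%:R ^+ k * q], and each step back extracts a p-th root. *)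
Lemma AS_neg_eq q q' : q < 0 -> q' < 0 ->
  (forall k, g (p%:R ^+ k.+1 * q) = g (p%:R ^+ k.+1 * q')) -> z q = z q'.
Proof.
move=> q0 q'0 gq; have [k0 k0P] := neg_eventually0 z q0.
have [k1 k1P] := neg_eventually0 z q'0.
suff h i k : (i + k = k0 + k1)%N -> z (p%:R ^+ k * q) = z (p%:R ^+ k * q').
  by have := h (k0 + k1)%N 0%N (addn0 _); rewrite !mul1r.
elim: i k => [|i IHi] k; first by rewrite add0n => ->; rewrite k0P ?leq_addr // k1P ?leq_addl.
move=> ik; have /IHi : (i + k.+1 = k0 + k1)%N by lia.
by move=> h; apply: frob_inj; rewrite !zgN !mulrA -!exprS h gq.
Qed.

Lemma AS_pos_supp q : 0 < q -> z q != 0 -> exists k, g (q / p%:R ^+ k) != 0.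
Proof.
move=> q0; apply: contraPP => none; have [k0 k0P] := pos_eventually0 z q0.
suff h i k : (i + k = k0)%N -> z (q / p%:R ^+ k) = 0.
  by have := h k0 0%N (addn0 _); rewrite divr1 => ->; rewrite eqxx.
elim: i k => [|i IHi] k; first by rewrite add0n => ->; rewrite k0P.
move=> ik; have /IHi : (i + k.+1 = k0)%N by lia.
rewrite exprSr invfM mulrA => /(congr1 (fun a => a ^+ p)); rewrite zgE.
rewrite expr0n gtn_eqF ?prime_gt0 // [g _](_ : _ = 0) ?addr0 //.
by apply: contrapT => /eqP gk; apply: none; exists k.
Qed.

Lemma AS_neg_supp q : q < 0 -> z q != 0 -> exists k, g (p%:R ^+ k * q) != 0.
Proof.
move=> q0; apply: contraPP => none; have [k0 k0P] := neg_eventually0 z q0.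
suff h i k : (i + k = k0)%N -> z (p%:R ^+ k * q) = 0.
  by have := h k0 0%N (addn0 _); rewrite mul1r => ->; rewrite eqxx.
elim: i k => [|i IHi] k; first by rewrite add0n => ->; rewrite k0P.
move=> ik; have /IHi h : (i + k.+1 = k0)%N by lia.
apply/eqP; have := zgN (p%:R ^+ k * q); rewrite mulrA -exprS h add0r.
rewrite [g _](_ : _ = 0); last by apply: contrapT => /eqP gk; apply: none; exists k.+1.
by move/eqP; rewrite expf_eq0 prime_gt0.
Qed.

(** For [q > 0], multiplication by p^k moves digits into the integer part, so the digit sum does not
    grow. For [q < 0], division turns an integer part of size at most [b] into digits of sum at most
    [b]. *)
Lemma AS_supp : digit_supp p (c + b) b z.
Proof.
move=> q zq; case: (ltgtP q 0) => [q0|q0|->]; last first.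
- by exists 0, [::]; split; rewrite ?subr0 //; lia.
- have [k /gsupp[n [w [bn /andP[dw sw] qE]]]] := AS_pos_supp q0 zq.
  have pk0 : p%:R ^+ k != 0 :> rat by rewrite expf_neq0.
  (* The padding guarantees [k] digits to move. *)
  have [|m mE] := @mul_digits k n (w ++ zeros k); first by rewrite size_cat size_nseq leq_addl.
  have {mE} := mE [::]; rewrite !cats0 dv_cat_zeros -qE mulrC divfK // => qE'.
  have dd : dg (drop k (w ++ zeros k)).
    have dz : dg (w ++ zeros k) by rewrite all_cat dw dg_zeros.
    by apply/allP => d /mem_drop/(allP dz).
  exists m, (drop k (w ++ zeros k)); split=> //.
    have : 0 < m%:~R :> rat by apply: lt_le_trans q0 _; rewrite qE' gerBl dv_ge0.
    by rewrite ltr0z; lia.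
  rewrite /digits_ok dd /=; have := congr1 sumn (cat_take_drop k (w ++ zeros k)).
  by rewrite !sumn_cat sumn_nseq mul0n; lia.
- have [k /gsupp[n [w [bn /andP[dw sw] qE]]]] := AS_neg_supp q0 zq.
  have pk0 : p%:R ^+ k != 0 :> rat by rewrite expf_neq0.
  have n0 : n <= 0.
    have : n%:~R < 1%:~R :> rat.
      rewrite -[X in X < _](subrK (dv w)) -qE.
      have := dv_lt1 p_gt1 dw.
      have : p%:R ^+ k * q < 0 by rewrite pmulr_rlt0 // exprn_gt0 // ltr0n prime_gt0.
      by rewrite -[1%:~R]/1; lra.
    by rewrite ltr_int; lia.
  have [m [s [ds /(_ n0)[m0 sm] /(_ w)]]] := div_digits k n.
  rewrite -qE mulrC mulKf // => qE'.
  exists m, (s ++ w); split=> //; first lia.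
  by rewrite /digits_ok all_cat ds dw sumn_cat /=; lia.
Qed.

(** At negative exponents the integer part lies between [- b] and 0 and strings can be shortened, so
    [g] takes finitely many values there. The recursion carries the common finite field over to
    [z]. *)
Lemma AS_frob_fixed : exists2 k, (0 < k)%N &
  forall q, q < 0 -> z q ^+ (p ^ (k * N)) = z q.
Proof.
have [l lP] := strings_finite (short_len c M N).
have [k k0 ks] := frob_fixed_seq
  [seq g ((- i%:Z)%:~R - dv w) | i <- iota 0 b.+1, w <- l] N_gt0.
exists k => //.
have gfix q : q < 0 -> g q ^+ (p ^ (k * N)) = g q.
  move=> q0; have [->|gq] := eqVneq (g q) 0.
    by rewrite frob0.
  have [n [w [bn ok qE]]] := gsupp gq.
  have n0 : n <= 0.
    have : n%:~R < 1%:~R :> rat.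
      have := dv_lt1 p_gt1 (proj1 (andP ok)); move: q0; rewrite qE.
      by rewrite -[1%:~R]/1; lra.
    by rewrite ltr_int; lia.
  have [w' [dw' sw'] gE] := short_string p_pr N_gt0 gper n ok.
  apply: ks; rewrite qE gE (_ : n = - `|n|%N%:Z); last lia.
  by apply: allpairs_f; [rewrite mem_iota; lia | apply: lP].
move=> q q0; have [k0' k0P] := neg_eventually0 z q0.
suff h i j : (i + j = k0')%N ->
    z (p%:R ^+ j * q) ^+ (p ^ (k * N)) = z (p%:R ^+ j * q).
  by have := h k0' 0%N (addn0 _); rewrite !mul1r.
elim: i j => [|i IHi] j.
  by rewrite add0n => ->; rewrite k0P // frob0.
move=> ij; have /IHi h : (i + j.+1 = k0')%N by lia.
apply: frob_inj; rewrite -exprM mulnC exprM zgN mulrA -exprS frobD h gfix //.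
by rewrite pmulr_rlt0 // exprn_gt0 // ltr0n prime_gt0.
Qed.

(* The point is m - dv (u 0^n v) with m < 0 or u <> 0: multiplying by p^k moves
   the head u and the gap one digit at a time across the radix point, until the
   integer part leaves the support of g. *)
Lemma AS_neg_gap R (m : int) u v n : (forall (m : int) u n, dg u -> (M <= n)%N ->
    g (m%:~R - dv (u ++ zeros (n + R) ++ v)) = g (m%:~R - dv (u ++ zeros n ++ v))) ->
  dg u -> dg v -> m%:~R - dv u < 0 -> (M + b < n)%N ->
  z (m%:~R - dv (u ++ zeros (n + R) ++ v)) = z (m%:~R - dv (u ++ zeros n ++ v)).
Proof.
move=> gR du dw mu nM.
have p0 k : 0 < p%:R ^+ k :> rat by rewrite exprn_gt0 // ltr0n prime_gt0.
have neg n' : m%:~R - dv (u ++ zeros n' ++ v) < 0.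
  apply: le_lt_trans mu; rewrite dv_cat lerD2l lerN2 lerDl.
  by rewrite divr_ge0 ?dv_ge0 // ltW.
apply: AS_neg_eq => // k0; move: k0.+1 => {}k.
have [ku|uk] := leqP k (size u).
  have [m' m'E] := mul_digits m ku; rewrite !m'E; apply: gR; last lia.
  by apply/allP => d /mem_drop/(allP du).
have [i kE] : exists i, k = (size u + i)%N by exists (k - size u)%N; lia.
have [m' m'E] := mul_digits m (leqnn (size u)).
have shiftE n' : p%:R ^+ k * (m%:~R - dv (u ++ zeros n' ++ v)) =
    p%:R ^+ i * (m'%:~R - dv (zeros n' ++ v)).
  by rewrite kE addnC exprD -mulrA m'E drop_size.
have m'0 : m' <= -1.
  have := m'E [::]; rewrite drop_size cats0 subr0 => e.
  have : m'%:~R < 0 :> rat by rewrite -e pmulr_rlt0.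
  by rewrite ltrz0; lia.
(* Once the head is used up, at most [b] zeros of the gap are consumed while [g] can be nonzero;
   [M + b < n] leaves at least [M]. *)
rewrite !shiftE; have [ib|bi] := leqP i b.
  have [|m2 m2E] := @mul_digits i m' (zeros i); first by rewrite size_nseq.
  have e n' : (i <= n')%N -> p%:R ^+ i * (m'%:~R - dv (zeros n' ++ v)) =
      m2%:~R - dv ([::] ++ zeros (n' - i) ++ v).
    move=> ni; rewrite -{1}(subnKC ni) nseqD -catA m2E drop_oversize ?size_nseq //.
  rewrite !e; try lia; rewrite -addnBAC; last lia.
  by apply: gR => //; lia.
(* For [i > b] the exponent is at most -p^i, hence at most -(b + 2), below the support of [g]. *)
have zero n' : g (p%:R ^+ i * (m'%:~R - dv (zeros n' ++ v))) = 0.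
  apply: contrapT => /eqP /gsupp[n0 [w [bn /andP[dw' _] e]]].
  have h1 : p%:R ^+ i * (m'%:~R - dv (zeros n' ++ v)) <= - (b.+2)%:R.
    apply: le_trans (_ : p%:R ^+ i * (-1) <= _).
      rewrite ler_pM2l //; have : m'%:~R <= (-1)%:~R :> rat by rewrite ler_int.
      have := dv_ge0 p (zeros n' ++ v); rewrite -[(-1)%:~R]/(-1); lra.
    rewrite mulrN1 lerN2 -natrX ler_nat; apply: leq_trans (ltn_expl i p_gt1).
    by lia.
  have := dv_lt1 p_gt1 dw'; have : (- b%:Z)%:~R <= n0%:~R :> rat by rewrite ler_int.
  move: h1; rewrite e rmorphN /= -!pmulrn -2!natr1; lra.
by rewrite !zero.
Qed.

Lemma AS_good : exists2 N', (0 < N')%N & good p (c + b) (M + b).+1 N' z.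
Proof.
have [k k0 zfix] := AS_frob_fixed; pose r := (k * N)%N.
have r0 : (0 < r)%N by rewrite muln_gt0 k0.
(* The factor p is the one of [frob_recurrence_periodic]. *)
exists (p * r)%N; first by rewrite muln_gt0 r0 prime_gt0.
split; first by exists b; apply: AS_supp.
have gr := gap_periodic_mul k gper; have gpr := gap_periodic_mul p gr.
move=> m u v n du dw nM.
have [m0|m0] := ltP 0 m.
  have pos w : dg w -> 0 < m%:~R - dv w.
    move=> dw'; rewrite subr_gt0; apply: lt_le_trans (dv_lt1 p_gt1 dw') _.
    by rewrite -[1]/(1%:~R) ler_int.
  apply: AS_pos_eq; try by apply/pos/dg_ins.
  move=> i; have [m' [s [ds _ sE]]] := div_digits i m; rewrite !sE !catA -!(catA _ _ v).
  by apply: gpr; rewrite ?all_cat ?ds //; lia.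
(* Unless [m] and [u] are both zero, the head is negative and [AS_neg_gap] applies. Otherwise the
   gap starts at the radix point. *)
have [u0|u0] := boolP ((m == 0) && (sumn u == 0%N)); last first.
  apply: AS_neg_gap => //; first by move=> m1 u1 n1 du1 Mn1; apply: gpr.
  have := dv_ge0 p u; have : m%:~R <= 0 :> rat by rewrite lerz0.
  rewrite le_eqVlt => /orP[|mn um]; last lra.
  rewrite intr_eq0 => m0' ; rewrite le_eqVlt => /orP[/eqP/esym/dv_eq0 su|].
    by move: u0; rewrite m0' su.
  by rewrite (eqP m0') sub0r oppr_lt0.
have [/eqP-> /eqP/sumn_eq0 uE] := andP u0.
have [v0|v0] := posnP (sumn v).
  by rewrite (sumn_eq0 v0) -!nseqD !dv_cat_zeros.
have dv0 : 0 < dv v.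
  rewrite lt_neqAle (dv_ge0 p v) andbT; apply/eqP => /esym/(dv_eq0 p_gt1); lia.
(* Widening this gap is division by p, so [z] along [pt] obeys the Artin-Schreier recurrence. *)
pose pt i := 0%:~R - dv (zeros i ++ v).
have ptS i : pt i.+1 = pt i / p%:R by rewrite /pt !sub0r /= add0r mulNr.
have ptneg i : pt i < 0.
  rewrite /pt sub0r oppr_lt0 dv_zeros divr_gt0 // exprn_gt0 // ltr0n prime_gt0 //.
rewrite uE !catA -!nseqD addnA -!/(pt _).
apply: (@frob_recurrence_periodic (fun i => z (pt i)) (fun i => g (pt i)) r M).
- by move=> i; rewrite ptS zgE.
- by move=> i; apply: zfix.
- by move=> i Mi; apply: (gr 0 [::] v i).
- lia.
Qed.

End Solution.

End ArtinSchreier.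

(** * Additive equations *)

Section Additive.
Variables (K : closedFieldType) (p : nat).
Hypothesis p_pr : prime p.
Hypothesis hchar : p \in [pchar K].

Let p_gt1 : (1 < p)%N := prime_gt1 p_pr.

Lemma hahn_frobD (x y : hahn K) k : (x + y) ^+ (p ^ k) = x ^+ (p ^ k) + y ^+ (p ^ k).
Proof.
elim: k => [|k IHk]; first by rewrite !expr1.
by rewrite expnSr !exprM IHk -!(pFrobenius_autE (hahn_char hchar)) rmorphD.
Qed.

Lemma hahn_frobB (x y : hahn K) k : (x - y) ^+ (p ^ k) = x ^+ (p ^ k) - y ^+ (p ^ k).
Proof.
elim: k => [|k IHk]; first by rewrite !expr1.
by rewrite expnSr !exprM IHk -!(pFrobenius_autE (hahn_char hchar)) rmorphB.
Qed.

Lemma hmono_mul a b (c d : K) : hmono a c * hmono b d = hmono (a + b) (c * d).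
Proof.
apply: hahn_eq => q; rewrite hmonoM /= subr_eq [b + a]addrC.
by case: ifP; rewrite ?mulr0.
Qed.

Lemma hmono01 : hmono 0 1 = 1 :> hahn K.
Proof. exact: hahn_eq. Qed.

Lemma hmono_laurent (n : int) (c : K) : is_laurent (hmono n%:~R c).
Proof. by exists n => q /hmono_neq0->; exists n. Qed.

Lemma lemb_neq0 (l : laurent K) : l != 0 -> lemb l <> 0.
Proof. by move=> l0 h; move/eqP: l0; apply; apply: lemb_inj. Qed.

Lemma lemb_mulKf (l : laurent K) (x : hahn K) : l != 0 -> lemb l^-1 * (lemb l * x) = x.
Proof. by move=> l0; rewrite mulrA -rmorphM mulVf // rmorph1 mul1r. Qed.

Lemma nngX1 (f : hahn K) n : nng 1 f -> nng 1 (f ^+ n.+1).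
Proof.
move=> f1; elim: n => [//|n IHn]; rewrite exprS.
exact: (@nngW _ 1 2) (nngM f1 IHn).
Qed.

Lemma frob_local (f g : hahn K) n i m : nng 1 f -> nng 1 g ->
  (forall k, (k < n)%N -> f k%:R = g k%:R) -> (m <= n)%N ->
  (f ^+ (p ^ i.+1)) m%:R = (g ^+ (p ^ i.+1)) m%:R.
Proof.
move=> f1 g1 fg mn; rewrite !(hcoef_pXn hchar); congr (_ ^+ _).
have p0 : (p ^ i.+1)%:R != 0 :> rat by rewrite pnatr_eq0 -lt0n expn_gt0 prime_gt0.
have [[k k0 kE]|none] :=
  pselect (exists2 k : nat, (0 < k)%N & m%:R / (p ^ i.+1)%:R = k%:R :> rat); last first.
  have zero h : nng 1 h -> h (m%:R / (p ^ i.+1)%:R) = 0 :> K.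
    by move=> h1; apply: contrapT => /eqP/h1[k k0 kE]; apply: none; exists k.
  by rewrite !zero.
rewrite kE; apply: fg; apply: leq_trans mn.
have : m%:R = (k * p ^ i.+1)%:R :> rat by rewrite natrM -kE divfK.
move=> /eqP; rewrite eqr_nat => /eqP->.
by rewrite ltn_Pmulr // -{1}(expn0 p) ltn_exp2l.
Qed.

(* Hensel: writing w = w0 + f with f of positive valuation, the equation reads
   f = - (sum C_i w0^(p^i)) - (C_0 - 1) f - sum_(i > 0) C_i f^(p^i), whose right
   hand side is contracting. *)
Lemma hensel d (C : nat -> hahn K) (w0 : K) :
  (forall i, nng 0 (C i)) -> C 0%N 0 = 1 ->
  \sum_(i < d.+1) C i 0 * w0 ^+ (p ^ i) = 0 ->
  exists2 f, nng 1 f & \sum_(i < d.+1) C i * (hmono 0 w0 + f) ^+ (p ^ i) = 0.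
Proof.
move=> C0 C00 Cw0.
have nng01 x : nng 0 x -> x 0 = 0 -> nng 1 x.
  move=> xn x0 q xq; have [[|n] _ qn] := xn q xq; last by exists n.+1.
  by move: xq; rewrite qn x0 eqxx.
pose G := \sum_(i < d.+1) C i * hmono 0 (w0 ^+ (p ^ i)).
have G1 : nng 1 G.
  apply: nng01.
    apply: nng_sum => i _; apply: (@nngM _ 0 0) => //.
    exact: (@nng_mono _ 0).
  rewrite hcoef_sum -[RHS]Cw0; apply: eq_bigr => i _.
  by rewrite mulrC hmonoM subr0 mulrC.
have C1 : nng 1 (C 0%N - 1).
  apply: nng01; last by rewrite hcoefD hcoefN C00 hcoef1 eqxx subrr.
  apply: nngD => //; apply: nngN; rewrite -hmono01; exact: (@nng_mono _ 0).
have [||f f1 fE] := @contraction_fixpoint K (fun f =>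
   - (G + (C 0%N - 1) * f + \sum_(i < d) C i.+1 * f ^+ (p ^ i.+1))).
- move=> f f1; apply: nngN; apply: nngD; first apply: nngD => //.
    exact: (@nngW _ 1 2) (nngM C1 f1).
  apply: nng_sum => i _; apply: (@nngM _ 0 1) => //.
  by rewrite -[X in f ^+ X]prednK ?expn_gt0 ?prime_gt0 //; apply: nngX1.
- move=> f g n f1 g1 fg; rewrite !hcoefN !hcoefD !hcoef_sum.
  have W := @nngW _ 0 1.
  congr (- (_ + _ + _)).
    by apply: (nngM_local C1); try exact: W; move=> i; rewrite addn1; apply: fg.
  apply: eq_bigr => i _; apply: (nngM_local (C0 i.+1)).
  + by rewrite -[X in f ^+ X]prednK ?expn_gt0 ?prime_gt0 //; apply: W => //; apply: nngX1.
  + by rewrite -[X in g ^+ X]prednK ?expn_gt0 ?prime_gt0 //; apply: W => //; apply: nngX1.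
  + by move=> m; rewrite addn0; apply: frob_local.
exists f => //.
under eq_bigr => i _ do rewrite hahn_frobD mulrDr hmonoX mulr0.
rewrite big_split /= -/G big_ord_recl /= expr1.
have fE' : f + (G + (C 0%N - 1) * f + \sum_(i < d) C i.+1 * f ^+ (p ^ i.+1)) = 0.
  by rewrite -{1}fE addNr.
rewrite -[RHS]fE'; set S := \sum_(i < d) _; ring.
Qed.

(** Choose [j] maximizing (v_0 - v_j) / (p^j - 1). After scaling exponents by p^j - 1, a root of
    order [sg] gives the terms 0 and [j] the same lowest order, and no term a lower one. Dividing by
    the leading part of term 0 leads to [hensel]. *)
Lemma newton_root d (A : nat -> laurent K) : A 0%N != 0 ->
  (exists i, [/\ (0 < i)%N, (i <= d)%N & A i != 0]) ->
  exists a (w : laurent K), w != 0 /\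
    \sum_(i < d.+1) hscale a (lemb (A i)) * lemb w ^+ (p ^ i) = 0.
Proof.
move=> A00 [i1 [i10 i1d Ai1]].
have exv i : exists v : int, A i != 0 -> lemb (A i) v%:~R != 0 /\
    forall q, lemb (A i) q != 0 -> exists2 n : int, q = n%:~R & v <= n.
  have [->|Ai] := eqVneq (A i) 0; first by exists 0 => /eqP.
  have [v vP] := lead_term (lemb_laurent (A i)) (lemb_neq0 Ai).
  by exists v.
have [v vP] := choice exv.
pose s (i : 'I_d.+1) : rat := (v 0%N - v i)%:~R / (p ^ i - 1)%N%:R.
have pi1 (i : nat) : (0 < i)%N -> (0 < p ^ i - 1)%N.
  by move=> i0; rewrite subn_gt0 -{1}(expn0 p) ltn_exp2l.
have i1d' : (i1 < d.+1)%N by [].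
have [|j /andP[j0 Aj] jmax] := @Order.TotalTheory.arg_maxP _ _ _ (Ordinal i1d')
  (fun i : 'I_d.+1 => (0 < i)%N && (A i != 0)) s; first by rewrite /= i10.
pose a := (p ^ j - 1).-1; have aE : a.+1 = (p ^ j - 1)%N by rewrite prednK ?pi1.
pose sg := v 0%N - v j.
pose b0 := lemb (A 0%N) (v 0%N)%:~R.
have b00 : b0 != 0 by have [] := vP 0%N A00.
have slope i : (i <= d)%N -> A i != 0 ->
    v 0%N * a.+1%:Z + sg <= v i * a.+1%:Z + (p ^ i)%:Z * sg.
  case: i => [|i] id Ai; first by rewrite expn0 mul1r.
  have id' : (i.+1 < d.+1)%N by [].
  have := jmax (Ordinal id'); rewrite /= Ai => /(_ isT); rewrite /s /= -/sg -aE.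
  rewrite ler_pdivrMr ?ltr0n ?pi1 // mulrAC ler_pdivlMr ?ltr0n //.
  rewrite !pmulrn -!rmorphM /= ler_int.
  have : (p ^ i.+1 - 1)%N%:Z = (p ^ i.+1)%:Z - 1 by have := pi1 i.+1 isT; lia.
  by move=> ->; nia.
pose e i : int := (p ^ i)%:Z * sg - sg - v 0%N * a.+1%:Z.
pose C i : hahn K := hmono (e i)%:~R b0^-1 * hscale a (lemb (A i)).
have a0 : a.+1%:R != 0 :> rat by rewrite pnatr_eq0.
have C_nng i : (i <= d)%N -> nng 0 (C i).
  move=> id q; rewrite hmonoM mulf_eq0 negb_or hscaleE => /andP[_].
  have [Ai|Ai] := eqVneq (A i) 0; first by rewrite Ai rmorph0 eqxx.
  move=> /(proj2 (vP i Ai))[n qn vn].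
  have qE : q = (n * a.+1%:Z + e i)%:~R.
    by rewrite rmorphD rmorphM /= -qn divfK // subrK.
  have := slope i id Ai; have : v i * a.+1%:Z <= n * a.+1%:Z by rewrite ler_pM2r.
  move=> h1 h2; exists (absz (n * a.+1%:Z + e i)) => //.
  by rewrite {1}qE pmulrn gez0_abs // /e; lia.
have C_at0 i : C i 0 = b0^-1 * lemb (A i) ((- e i)%:~R / a.+1%:R).
  by rewrite hmonoM hscaleE sub0r rmorphN.
have C00 : C 0%N 0 = 1.
  rewrite C_at0 /e expn0 mul1r subrr sub0r opprK rmorphM /= mulfK //.
  by rewrite mulVf.
have Cj0 : C j 0 != 0.
  rewrite C_at0 mulf_neq0 ?invr_eq0 // (_ : (- e j)%:~R / _ = (v j)%:~R).
    by have [] := vP j Aj.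
  apply: (mulIf a0); rewrite divfK // -[a.+1%:R]/((a.+1%:Z)%:~R) -rmorphM; congr (_%:~R).
  have : a.+1%:Z = (p ^ j)%:Z - 1 by have := pi1 j j0; lia.
  by move=> ->; rewrite /e /sg; lia.
(* [hensel] asks for integrality at all indices; [C_nng] gives it only up to [d]. *)
pose C' i := if (i <= d)%N then C i else 0.
have C'E (i : 'I_d.+1) : C' i = C i by rewrite /C' -ltnS ltn_ord.
(* The residue equation divided by its unknown: the constant term 1 forces a nonzero root, and the
   term [j] makes [P] nonconstant. *)
pose P : {poly K} := \sum_(i < d.+1) C' i 0 *: 'X^(p ^ i - 1).
have Pcoef (i : 'I_d.+1) : P`_(p ^ i - 1) = C i 0.
  rewrite coef_sum (bigD1 i) //= coefZ coefXn eqxx mulr1 C'E big1 ?addr0 // => k ki.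
  rewrite coefZ coefXn [_ == _](_ : _ = false) ?mulr0 //; apply/eqP => pk.
  move/eqP: ki; apply; apply/val_inj/eqP => /=; rewrite -(eqn_exp2l _ _ p_gt1).
  have pos m : (0 < p ^ m)%N by rewrite expn_gt0 prime_gt0.
  by have := pos i; have := pos k; lia.
have [w0 rw0] : exists w0, root P w0.
  apply/closed_rootP; apply: contraTneq (Cj0) => sP.
  rewrite -Pcoef nth_default ?eqxx // sP; exact: pi1.
have Pw0 : \sum_(i < d.+1) C' i 0 * w0 ^+ (p ^ i - 1) = 0.
  move: rw0 => /rootP; rewrite horner_sum => h; rewrite -[RHS]h.
  by apply: eq_bigr => i _; rewrite hornerZ hornerXn.
have w00 : w0 != 0.
  apply: contraTneq rw0 => ->; rewrite rootE horner_coef0.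
  have -> : P`_0 = 1 by rewrite -C00; apply: (Pcoef ord0).
  by rewrite oner_eq0.
have [|||f f1 fE] := @hensel d C' w0.
- by move=> i; rewrite /C'; case: ifP => [/C_nng//|_]; exact: nng0.
- by rewrite /C' leq0n.
- transitivity (w0 * \sum_(i < d.+1) C' i 0 * w0 ^+ (p ^ i - 1)); last by rewrite Pw0 mulr0.
  rewrite big_distrr; apply: eq_bigr => i _ /=.
  by rewrite mulrCA -exprS -subSn ?expn_gt0 ?prime_gt0 // subn1.
have lw : is_laurent (hmono sg%:~R 1 * (hmono 0 w0 + f)).
  have [l1 l1E] := laurent_lemb (hmono_laurent sg 1).
  have [l2 l2E] : exists l, lemb l = hmono 0 w0 + f.
    apply: laurent_lemb; apply: (@nng_laurent _ 0); apply: nngD; last exact: (@nngW _ 0 1).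
    exact: (@nng_mono _ 0).
  by rewrite -l1E -l2E -rmorphM; apply: lemb_laurent.
have [w wE] := laurent_lemb lw.
exists a, w; split.
  apply/eqP => w_0; move: wE; rewrite w_0 rmorph0 => /(congr1 (fun x : hahn K => x sg%:~R)).
  rewrite hcoef0 hmonoM subrr mul1r hcoefD /= [f 0](_ : _ = 0).
    by rewrite addr0 => /esym/eqP; rewrite (negPf w00).
  apply: contrapT => /eqP/f1[n n0 /eqP]; rewrite eq_sym pnatr_eq0; lia.
transitivity (hmono (sg + v 0%N * a.+1%:Z)%:~R b0 *
    \sum_(i < d.+1) C' i * (hmono 0 w0 + f) ^+ (p ^ i)); last by rewrite fE mulr0.
rewrite big_distrr; apply: eq_bigr => i _ /=.
have mm : hmono (sg + v 0%N * a.+1%:Z)%:~R b0 * hmono (e i)%:~R b0^-1 =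
    hmono ((p ^ i)%:R * sg%:~R) 1.
  rewrite hmono_mul divff // -rmorphD -[(p ^ i)%:R]/((p ^ i)%:Z%:~R) -rmorphM.
  by rewrite (_ : _ + e i = (p ^ i)%:Z * sg) // /e; lia.
rewrite wE C'E exprMn hmonoX expr1n /C -[X in _ = _ * X]mulrA [RHS]mulrA mm.
by rewrite mulrCA.
Qed.

(** The Artin-Schreier constructor passes from the right-hand side to any solution, so goodness
    follows by induction. *)
Inductive tower : hahn K -> Prop :=
| tower0 : tower 0
| towerAS z : tower (z ^+ p - z) -> tower z
| towerM (l : laurent K) z : tower z -> tower (lemb l * z).

Lemma summation_by_parts (R : pzRingType) (C u : nat -> R) n :
  \sum_(i < n) (- \sum_(j < i.+1) C j) * (u i.+1 - u i) =
  \sum_(i < n.+1) C i * u i - (\sum_(j < n.+1) C j) * u n.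
Proof.
elim: n => [|n IHn]; first by rewrite big_ord0 !big_ord1 subrr.
rewrite big_ord_recr /= IHn mulNr mulrBr opprB addrA subrK.
by rewrite [X in _ = X - _]big_ord_recr [X in _ = _ - X * _]big_ord_recr /= mulrDl opprD addrACA subrr addr0.
Qed.

(* If w is a root of the additive operator, then the substitution x = w z makes
   the coefficients sum to 0, and summation by parts factors out z^p - z. *)
Lemma additive_tower d (A : nat -> laurent K) x : A 0%N != 0 ->
  \sum_(i < d.+1) lemb (A i) * x ^+ (p ^ i) = 0 -> exists a, tower (hscale a x).
Proof.
elim: d A x => [|d IHd] A x A0.
  rewrite big_ord1 expr1 => Ax; exists 0%N.
  by rewrite -[x](lemb_mulKf x A0) Ax mulr0 hscale0; exact: tower0.
have [exi|none] := pselect (exists i, [/\ (0 < i)%N, (i <= d.+1)%N & A i != 0]); last first.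
  rewrite big_ord_recl expr1 big1 ?addr0 => [Ax|i _]; last first.
    have -> : A (lift ord0 i) = 0; last by rewrite rmorph0 mul0r.
    by apply: contrapT; rewrite lift0 => /eqP Ai; apply: none; exists i.+1; split.
  exists 0%N; by rewrite -[x](lemb_mulKf x A0) Ax mulr0 hscale0; exact: tower0.
have [a [w [w0 wE]]] := newton_root A0 exi => Ax.
have [A' A'E] := choice (fun i => laurent_lemb (hscale_laurent a (lemb_laurent (A i)))).
pose x' := hscale a x.
have [z x'E] : exists z, x' = lemb w * z.
  by exists (lemb w^-1 * x'); rewrite -{1}[w]invrK lemb_mulKf // invr_eq0.
pose C i := A' i * w ^+ (p ^ i).
have Cz : \sum_(i < d.+2) lemb (C i) * z ^+ (p ^ i) = 0.
  transitivity (hscale a (\sum_(i < d.+2) lemb (A i) * x ^+ (p ^ i))).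
    rewrite hscale_sum; apply: eq_bigr => i _.
    by rewrite hscaleM hscaleX -/x' x'E -A'E exprMn mulrA /C rmorphM rmorphXn.
  by rewrite Ax hscale0.
have C0 : \sum_(i < d.+2) lemb (C i) = 0.
  by rewrite -[RHS]wE; apply: eq_bigr => i _; rewrite /C rmorphM rmorphXn /= A'E.
have C00 : C 0%N != 0.
  rewrite mulf_neq0 // ?expf_neq0 //; apply/eqP => h.
  have := A'E 0%N; rewrite h rmorph0 -[0](hscale0 _ a) => /hscale_inj/esym.
  exact: lemb_neq0.
(* The quotient operator has one term fewer and coefficient [- C 0] at the identity, again
   nonzero. *)
have [||a' ta'] := IHd (fun i => - \sum_(j < i.+1) C j) (z ^+ p - z).
- by rewrite big_ord1 oppr_eq0.
- under eq_bigr => i _ do rewrite rmorphN rmorph_sum hahn_frobB -exprM -expnS.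
  by rewrite (summation_by_parts (fun i => lemb (C i)) (fun i => z ^+ (p ^ i))) Cz C0 mul0r subrr.
exists (a'.+1 * a.+1).-1; rewrite -hscale_comp -/x' x'E hscaleM.
have [l lE] := laurent_lemb (hscale_laurent a' (lemb_laurent w)).
rewrite -lE; apply/towerM/towerAS.
by move: ta'; rewrite hscaleD hscaleN hscaleX.
Qed.

Hypothesis halg : forall z : K, exists2 k : nat, (0 < k)%N & z ^+ (p ^ k) = z.

Lemma tower_good x : tower x -> exists c M N, (0 < N)%N /\ good p c M N x.
Proof.
elim=> [|z _ [c [M [N [N0 [[b gs] gp]]]]]|l z _ [c [M [N [N0 gz]]]]].
- by exists 0%N, 0%N, 1%N; split=> //; exact: good0.
- have [N' N'0 gz] := AS_good p_pr hchar halg N0 gs gp (erefl _).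
  by exists (c + b)%N, (M + b).+1, N'.
- by exists c, M, N; split=> //; apply: goodM.
Qed.

(** If [r] is the first index with a nonzero coefficient, the relation is one for [x ^+ (p ^ r)]
    whose first coefficient is nonzero. *)
Lemma integral_good (x : hahn K) : integral_over_laurent x ->
  exists a c M N, (0 < N)%N /\ good p c M N (hscale a x).
Proof.
move=> /(integral_additive p)[n [A [[i0 Ai0] Ax]]].
pose A' i := if insub i is Some j then A j else 0.
have A'E (i : 'I_n) : A' i = A i by rewrite /A' valK.
have exr : exists r, A' r != 0 by exists i0; rewrite A'E.
case: (ex_minnP exr) => r Ar rmin.
have rn : (r < n)%N.
  by rewrite ltnNge; apply: contra Ar => nr; rewrite /A' insubF // ltnNge nr.
have [||a ta] := @additive_tower (n - r).-1 (fun i => A' (r + i)%N) (x ^+ (p ^ r)).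
- by rewrite addn0.
- rewrite prednK ?subn_gt0 // -[RHS]Ax.
  transitivity (\sum_(i < n) lemb (A' i) * x ^+ (p ^ i)); last first.
    by apply: eq_bigr => i _; rewrite A'E.
  rewrite -(big_mkord xpredT (fun i => lemb (A' i) * x ^+ (p ^ i))).
  rewrite (big_cat_nat (n := r)) //=; last exact: ltnW.
  have -> : \sum_(0 <= i < r) lemb (A' i) * x ^+ (p ^ i) = 0.
    rewrite big_nat_cond big1 // => i /andP[/andP[_ ir] _].
    have -> : A' i = 0; last by rewrite rmorph0 mul0r.
    by apply: contrapT => /eqP /rmin; rewrite leqNgt ir.
  rewrite add0r.
  have := big_addn 0 n r xpredT (fun i => lemb (A' i) * x ^+ (p ^ i)).
  rewrite add0n => ->; rewrite big_mkord; apply: eq_bigr => i _.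
  by rewrite -exprM -expnD addnC.
have [c [M [N [N0 [[b gs] gp]]]]] := tower_good ta.
have pr0 : (0 < p ^ r)%N by rewrite expn_gt0 prime_gt0.
(* Coefficients of [x ^+ (p ^ r)] are p^r-th powers of those of [x] with exponents stretched by p^r.
   The stretch joins the scaling, and Frobenius is injective on [K]. *)
exists (((p ^ r).-1.+1 * a.+1).-1), c, M, N; split=> //.
have yE q : hscale a (x ^+ (p ^ r)) q = hscale ((p ^ r).-1.+1 * a.+1).-1 x q ^+ (p ^ r).
  by rewrite -hscale_comp hscaleX (hcoef_pXn hchar) [in RHS]hscaleE prednK.
split.
  exists b => q xq; apply: gs; rewrite yE expf_eq0 pr0 //.
move=> m u v k du dw Mk; apply: (frob_injX hchar (k := r)).
by rewrite -!yE; apply: gp.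
Qed.

End Additive.

(** A closed field of characteristic p in which each element is fixed by a power of Frobenius is an
    algebraic closure of $\mathbb{F}_p$. *)
Theorem theorem11p11 (p : nat) (K : closedFieldType)
  (hp : prime p) (hchar : p \in [pchar K])
  (halg : forall z : K, exists2 k : nat, (0 < k)%N & z ^+ (p ^ k) = z)
  (x : rat -> K) (hx : well_ordered_support x) :
  integral_over_laurent x <->
  ((exists (a : nat) (b : int) (c : nat),
       (0 < a)%N /\ supported_on x (S_abc p a b c)) /\
   (exists (a : nat) (b : int) (c : nat),
       [/\ (0 < a)%N, supported_on x (S_abc p a b c) &
       exists (M N : nat), (0 < N)%N /\
         forall m : int, - b <= m ->
         forall (j : nat) (bs : seq nat), (0 < j)%N -> digits_ok p c bs ->
           has (fun d => d != 0%N) bs ->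
           eventually_periodic
             (fun n => f_m x a m (shifted_point p bs j n)) M N])).
Proof.
have p_gt1 := prime_gt1 hp; pose X := Hahn hx.
have fE a (m : int) w j n : (0 < j)%N -> f_m x a.+1 m (shifted_point p w j n) =
    hscale a X (m%:~R - dv p (take j.-1 w ++ nseq n 0%N ++ drop j.-1 w)).
  by move=> j0; rewrite /f_m shifted_pointE.
split=> [xint|[_ [a [b [c [a0 xsupp [M [N [N0 xper]]]]]]]]].
  have [a [c [M [N [N0 [[b gs] gp]]]]]] := integral_good hp hchar halg (x := X) xint.
  have sx : supported_on x (S_abc p a.+1 b%:Z c).
    move=> q xq; have a0 : a.+1%:R != 0 :> rat by rewrite pnatr_eq0.
    have [|n [w [bn ok qE]]] := gs (q * a.+1%:R); first by rewrite hscaleE mulfK.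
    by exists n, w; split=> //; rewrite digvalE -qE mulfK.
  split; first by exists a.+1, b%:Z, c.
  exists a.+1, b%:Z, c; split=> //; exists M, N; split=> // m _ j w j0 /andP[dw _] _ n Mn.
  have dtd : all (fun d => d < p)%N (take j.-1 w) && all (fun d => d < p)%N (drop j.-1 w).
    by rewrite -all_cat cat_take_drop.
  by rewrite !fE //; case/andP: dtd => dt dd; apply: gp.
case: a a0 xsupp xper => [//|a] _ xsupp xper.
apply: (@good_integral K p hp hchar c M N a X N0).
have sX : forall q, hscale a X q != 0 -> exists (n : int) w,
    [/\ - b <= n, digits_ok p c w & q = n%:~R - dv p w].
  move=> q /xsupp[n [w [bn ok qE]]]; exists n, w; split=> //.
  by move: qE; rewrite digvalE => /(mulIf _); apply; rewrite invr_eq0 pnatr_eq0.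
have sX' : digit_supp p c `|b|%N (hscale a X).
  by move=> q /sX[n [w [bn ok qE]]]; exists n, w; split=> //; lia.
split; first by exists `|b|%N.
apply: (gap_periodicP hp sX') => m u v n _ ok Mn.
(* The given periodicity concerns nonzero strings only; for a zero string the gap does not move the
   exponent. *)
have [zuv|nz] := boolP (has (fun d => d != 0%N) (u ++ v)); last first.
  have uv0 w : all (fun d => d < p)%N w -> ~~ has (fun d => d != 0%N) w -> dv p w = 0.
    by elim: w => [//|d w IHw] /= /andP[_ dw]; rewrite negb_or negbK => /andP[/eqP-> /(IHw dw)->]; rewrite addr0 mul0r.
  have [du dw] : all (fun d => d < p)%N u /\ all (fun d => d < p)%N v.
    by move: ok => /andP[]; rewrite all_cat => /andP[].
  move: nz; rewrite has_cat negb_or => /andP[nu nv].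
  by rewrite !dv_cat !dv_all0 !(uv0 _ dw) // !mul0r.
(* The bound [- b] can exceed the bound from |b| kept in [sX']; in between, the coefficients
   vanish. *)
have [bm|mb] := lerP (- b) m; last first.
  have zero k : hscale a X (m%:~R - dv p (u ++ nseq k 0%N ++ v)) = 0.
    apply: contrapT => /eqP/sX[n' [w [bn /andP[dw _] e]]].
    have [du dw'] : all (fun d => d < p)%N u /\ all (fun d => d < p)%N v.
      by move: ok => /andP[]; rewrite all_cat => /andP[].
    have [mn _] := int_digits_uniq p_gt1 (dg_ins hp k du dw') dw e.
    by move: mb; rewrite mn ltNge bn.
  by rewrite !zero.
(* This index [j] puts the gap right after [u]. *)
have := xper m bm (size u).+1 (u ++ v) isT ok zuv n Mn.
by rewrite !fE //= take_size_cat // drop_size_cat.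
Qed.
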